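(* Let assumptions (a) and (b) of the context hold and let $L$ and $\mathbb{M}$ be as in the context. Assume that there exists $\varphi\in C^2(\mathbb{R}^d)$, $\varphi\ge0$, such that $\lim_{r\to\infty}(\inf_{\partial B_r}\varphi)=\infty$ and $$L\varphi\le M\varphi\quad\text{a.e. on }\mathbb{R}^d$$ for some constant $M>0$. Then $\mathbb{M}$ is non-explosive and for any $x\in\mathbb{R}^d$ it holds that $$\mathbb{E}_x[\varphi(X_t)]\le e^{Mt}\varphi(x),\qquad t\ge0.$$
   Context: Let $d\ge2$, $p\in(d,\infty)$, $q=\frac{pd}{p+d}$. $B_r$ is the open Euclidean ball of radius $r$ about $0$. For a matrix $B=(b_{ij})$ of functions, $\nabla B$ is the vector field with $i$-th component $\sum_j\partial_jb_{ij}$. Assumption (a): $A=(a_{ij})$ with $a_{ji}=a_{ij}\in H^{1,2}_{loc}(\mathbb{R}^d)\cap C(\mathbb{R}^d)$, such that for every relatively compact $V$ there is $\nu_V>0$ with $\nu_V^{-1}\|\xi\|^2\le\langle A(x)\xi,\xi\rangle\le\nu_V\|\xi\|^2$ for all $\xi\in\mathbb{R}^d$, $x\in V$; $C=(c_{ij})$ with $-c_{ji}=c_{ij}\in H^{1,2}_{loc}(\mathbb{R}^d)\cap C(\mathbb{R}^d)$; $\mathbf{H}\in L^p_{loc}(\mathbb{R}^d,\mathbb{R}^d)$. Put $\mathbf{G}=(g_1,\dots,g_d)=\tfrac12\nabla(A+C^T)+\mathbf{H}$ and $Lf=\tfrac12\sum_{i,j}a_{ij}\partial_{ij}f+\sum_ig_i\partial_if$,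 $f\in C^2(\mathbb{R}^d)$. Assumption (b): $\mathbf{G}\in L^q_{loc}(\mathbb{R}^d,\mathbb{R}^d)$. Measure: $\mu=\rho\,dx$, where $\rho\in H^{1,p}_{loc}(\mathbb{R}^d)\cap C(\mathbb{R}^d)$, $\rho>0$ everywhere, and $\int Lf\,d\mu=0$ for all $f\in C_0^\infty(\mathbb{R}^d)$ (such $\rho$ exists under (a); one is fixed). Semigroup: put $\beta^{\rho,A}_i=\tfrac12\sum_j(\partial_ja_{ij}+a_{ij}\tfrac{\partial_j\rho}\rho)$, $\mathbf{B}=\mathbf{G}-\beta^{\rho,A}$. For relatively compact open $V$ let $(L^{0,V},D(L^{0,V}))$ be the self-adjoint generator on $L^2(V,\mu)$ of the closure of $\tfrac12\int_V\langle A\nabla u,\nabla v\rangle d\mu$, $u,v\in C_0^\infty(V)$. The operator $L^{0,V}u+\langle\mathbf{B},\nabla u\rangle$ on bounded $u\in D(L^{0,V})$ is closable in $L^1(V,\mu)$ and its closure generates a sub-Markovian $C_0$-semigroup of contractions, with resolvent $\overline{G}^V_\alpha$; put $\overline{G}^V_\alpha f:=\overline{G}^V_\alpha(f1_V)$ (zero outside $V$) for $f\in L^1(\mathbb{R}^d,\mu)$. For relatively compact open $V_n\uparrow\mathbb{R}^d$ the limits $\overline{G}_\alpha f=\lim_n\overline{G}^{V_n}_\alpha f$ exist in $L^1(\mathbb{R}^d,\mu)$, do not depend on $(V_n)$, and form the resolvent of a sub-Markovian $C_0$-semigroup of contractions $(\overline{T}_t)_{t>0}$ on $L^1(\mathbb{R}^d,\mu)$,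 whose generator extends $(L,C_0^\infty(\mathbb{R}^d))$. $(T_t)_{t>0}$ denotes the sub-Markovian semigroup on every $L^s(\mathbb{R}^d,\mu)$, $s\in[1,\infty]$, obtained by restricting $(\overline{T}_t)$ to $L^1\cap L^\infty$ and extending. For $f\in\bigcup_{s\in[1,\infty]}L^s(\mathbb{R}^d,\mu)$ and $t>0$, $T_tf$ has a continuous $\mu$-version, denoted $P_tf$; $P_0=\mathrm{id}$. Process: under (a) and (b), $\mathbb{M}=(\Omega,\mathcal{F},(\mathcal{F}_t)_{t\ge0},(X_t)_{t\ge0},(\mathbb{P}_x)_{x\in\mathbb{R}^d\cup\{\Delta\}})$ is the Hunt process with state space $\mathbb{R}^d$, with continuous sample paths on the one-point compactification $\mathbb{R}^d_\Delta$ (absorbed at $\Delta$ after the lifetime $\zeta=\inf\{t\ge0:X_t=\Delta\}$), such that $P_tf(x)=\mathbb{E}_x[f(X_t)]$ for all $t\ge0$, $x\in\mathbb{R}^d$, $f$ bounded Borel, with $f(\Delta):=0$. $\mathbb{M}$ is non-explosive if $\mathbb{P}_x(\zeta=\infty)=1$ for all $x\in\mathbb{R}^d$. *)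

(* Defs.v *)
From HB Require Import structures.
From mathcomp Require Import all_boot all_order all_algebra.
From mathcomp Require Import all_classical all_reals all_analysis.
From mathcomp Require Import measurable_realfun.
Import Order.TTheory GRing.Theory Num.Def Num.Theory numFieldNormedType.Exports.
Set Implicit Arguments. Unset Strict Implicit. Unset Printing Implicit Defensive.
Local Open Scope classical_set_scope.
Local Open Scope ring_scope.

(* Borel sigma-algebras of the matrix spaces and of the one-point
   compactification of R^d *)
HB.instance Definition _ (R : realType) (m n : nat) :=
  @isMeasurable.Build (sigma_display (@open 'M[R]_(m, n))) 'M[R]_(m, n)
    <<s @open 'M[R]_(m, n) >> (@sigma_algebra0 _ setT _)
    (@sigma_algebraC _ _) (@sigma_algebra_bigcup _ setT _).

HB.instance Definition _ (R : realType) (d : nat) :=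
  let S := one_point_compactification 'rV[R]_d in
  @isMeasurable.Build (sigma_display (@open S)) S
    <<s @open S >> (@sigma_algebra0 _ setT _)
    (@sigma_algebraC _ _) (@sigma_algebra_bigcup _ setT _).

(* Lebesgue measure on R^d: the library's measure on R is iterated as a product
   on tuples, then transported to row vectors; [lebesgue_rV_box] checks its
   value on boxes. *)
Section lebesgue.
Context {R : realType}.

Definition image_measure d1 d2 (T1 : measurableType d1) (T2 : measurableType d2)
    (m : {measure set T1 -> \bar R}) (f : T1 -> T2)
    (mf : measurable_fun setT f) : {measure set T2 -> \bar R} :=
  measure_function_pushforward__canonical__measure_function_Measure m mf.

Definition cons_pair n (x : R * n.-tuple R) : n.+1.-tuple R :=
  [the n.+1.-tuple R of x.1 :: x.2].

Lemma measurable_cons_pair n : measurable_fun setT (@cons_pair n).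
Proof. exact: measurable_cons. Qed.

Fixpoint lebesgue_tuple n : {measure set (n.-tuple R) -> \bar R} :=
  match n with
  | 0 => dirac [tuple]
  | n'.+1 => image_measure (lebesgue_measure \x^ lebesgue_tuple n')%E
               (@measurable_cons_pair n')
  end.

Definition row_of_tuple n (t : n.-tuple R) : 'rV[R]_n := \row_i tnth t i.

Lemma measurable_row_of_tuple n : measurable_fun setT (@row_of_tuple n).
Proof.
apply: (@measurability _ _ _ _ setT _ (@open 'rV[R]_n)) => //.
move=> _ [U oU <-]; rewrite setTI.
pose F (ak : 'rV[rat]_n * nat) : set (n.-tuple R) :=
  [set t | ball (map_mx ratr ak.1 : 'rV[R]_n) ak.2.+1%:R^-1 `<=` U /\
     forall i, `|ratr (ak.1 0 i) - tnth t i| < ak.2.+1%:R^-1].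
have -> : @row_of_tuple n @^-1` U = \bigcup_ak F ak.
  apply/seteqP; split=> t /=; last first.
    move=> [[a k] _ [/= kU akt]]; apply: kU; split; first by rewrite invr_gt0.
    by move=> i j; rewrite ord1 !mxE; exact: akt.
  move: oU; rewrite openE => /[apply] /nbhs_ballP[e /= e0 eU].
  have [k ke] : exists k : nat, k.+1%:R^-1 < e / 2.
    have /ltr_add_invr[k] : 0 < e / 2 by rewrite divr_gt0.
    by rewrite add0r => ke; exists k.
  have kgt0 : (0 : R) < k.+1%:R^-1 by rewrite invr_gt0.
  have q_ex i : exists q : rat, `|ratr q - tnth t i| < k.+1%:R^-1.
    have : tnth t i - k.+1%:R^-1 < tnth t i + k.+1%:R^-1.
      by rewrite ltrBlDr -addrA ltrDl addr_gt0.
    move=> /rat_in_itvoo[q]; rewrite in_itv/= => qi.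
    by exists q; rewrite ltr_distl.
  exists (\row_i sval (cid (q_ex i)), k) => //; split => /=; last first.
    by move=> i; rewrite mxE; case: cid.
  move=> y [_ qy]; apply: eU; split => // i j; rewrite ord1.
  apply: (@ball_splitr _ _ (ratr (sval (cid (q_ex j))) : R)).
    apply: (le_ball (ltW ke)); rewrite /ball/= mxE.
    by case: cid.
  have := qy 0 j; rewrite !mxE; apply: le_ball; exact: ltW.
apply: countable_bigcupT_measurable => // -[a k].
have [aU|aU] :=
    pselect (ball (map_mx ratr a : 'rV[R]_n) k.+1%:R^-1 `<=` U); last first.
  by rewrite (_ : F _ = set0)//; apply/seteqP; split => // t [].
rewrite (_ : F _ = \bigcap_(i : 'I_n)
    ((fun t => tnth t i) @^-1` (ball (ratr (a 0 i) : R) k.+1%:R^-1))).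
  apply: fin_bigcap_measurable => // i _.
  rewrite -[X in measurable X]setTI; apply: measurable_tnth => //.
  by rewrite ball_itv; exact: measurable_itv.
apply/seteqP; split => t /=; first by move=> [_ h] i _; apply: h.
by move=> h; split => // i; exact: h.
Qed.

Definition lebesgue_rV n : {measure set 'rV[R]_n -> \bar R} :=
  image_measure (lebesgue_tuple n) (@measurable_row_of_tuple n).

Lemma lebesgue_rV_box n (a b : 'rV[R]_n) : (forall i, a 0 i <= b 0 i) ->
  lebesgue_rV n [set x : 'rV[R]_n | forall i, a 0 i < x 0 i <= b 0 i] =
  (\prod_i (b 0 i - a 0 i))%:E.
Proof.
move=> ab; rewrite /lebesgue_rV /= /pushforward.
have := ab; rewrite (_ : _ @^-1` _ =
  [set t : n.-tuple R | forall i, a 0 i < tnth t i <= b 0 i]); last first.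
  by apply/seteqP; split=> t /= h i; have := h i; rewrite ?mxE.
pose a' i := a 0 i; pose b' i := b 0 i.
rewrite -/(a' _) -/(b' _).
have -> : \prod_i (b 0 i - a 0 i) = \prod_i (b' i - a' i) by [].
move=> _; have {ab} : forall i, a' i <= b' i by [].
rewrite (_ : [set t : n.-tuple R | _] =
  [set t : n.-tuple R | forall i, a' i < tnth t i <= b' i])//.
move: a' b'; elim: n {a b} => [a b _|n ih a b ab].
  by rewrite big_ord0 /= diracE mem_set// => -[].
rewrite big_ord_recl /= /pushforward.
rewrite (_ : _ @^-1` _ = [set` `]a ord0, b ord0]] `*`
  [set t : n.-tuple R | forall i, a (lift ord0 i) < tnth t i <= b (lift ord0 i)]).
  rewrite [LHS]product_measure2E//=.
  - rewrite ih// lebesgue_measure_itv/= lte_fin -EFinD.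
    case: ltP => // ba; rewrite mul0e (_ : b ord0 - a ord0 = 0) ?mul0r//.
    by apply/eqP; rewrite subr_eq0 eq_le ba ab.
  - rewrite (_ : [set t | _] = \bigcap_(i : 'I_n)
        ((fun t => tnth t i) @^-1` [set` `]a (lift ord0 i), b (lift ord0 i)]])).
      apply: fin_bigcap_measurable => // i _.
      rewrite -[X in measurable X]setTI; apply: measurable_tnth => //.
    apply/seteqP; split => t /= h i; first by move=> _; rewrite /= in_itv; exact: h.
    by have := h i Logic.I; rewrite /= in_itv.
apply/seteqP; split => -[x t] /=.
  move=> h; split; first by have := h ord0; rewrite in_itv.
  by move=> i; have := h (lift ord0 i); rewrite tnthS.
move=> [x0 h] i; have [->|i0] := eqVneq i ord0; first by move: x0; rewrite in_itv.
case: (unliftP ord0 i) i0 => [j ->|-> /eqP//] _; rewrite tnthS; exact: h.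
Qed.

End lebesgue.


Section calculus.
Context {R : realType} {d : nat}.
Local Notation E := 'rV[R]_d.
Local Notation leb := (@lebesgue_rV R d).
Implicit Types (V : set E) (f g : E -> R) (i : 'I_d).

Definition dot (u v : E) : R := \sum_i u 0 i * v 0 i.

(* the norm `|x| of the library on 'rV[R]_d is the sup norm *)
Definition enorm (x : E) : R := Num.sqrt (dot x x).

(* the column-vector product M u, for u stored as a row *)
Definition mxv (M : 'M[R]_d) (u : E) : E := \row_i \sum_j M i j * u 0 j.

Definition partial i f (x : E) : R := 'D_(delta_mx 0 i) f x.

Definition grad f (x : E) : E := \row_i partial i f x.

Fixpoint Ck (k : nat) f : Prop :=
  match k with
  | 0 => continuous f
  | k'.+1 => continuous f /\
      forall i, (forall x, derivable f x (delta_mx 0 i)) /\ Ck k' (partial i f)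
  end.

(* C_0^oo(V) *)
Definition test_fun V f : Prop :=
  (forall k, Ck k f) /\
  exists K : set E, [/\ compact K, K `<=` V & forall x, ~ K x -> f x = 0].

Definition Lploc (p : R) V f : Prop :=
  measurable_fun V f /\
  forall K : set E, compact K -> K `<=` V ->
    (\int[leb]_(x in K) (`|f x| `^ p)%:E < +oo)%E.

(* g is the weak derivative of f in direction i on V *)
Definition is_wpartial V i f g : Prop :=
  [/\ Lploc 1 V f, Lploc 1 V g &
      forall psi, test_fun V psi ->
        \int[leb]_(x in V) (f x * partial i psi x) =
        - \int[leb]_(x in V) (g x * psi x)].

(* a version of the weak derivative, 0 if there is none *)
Definition wpartial V i f : E -> R :=
  xget (fun=> 0) [set g | is_wpartial V i f g].

Definition wgrad V f (x : E) : E := \row_i wpartial V i f x.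

(* H^{1,p}_loc(R^d) *)
Definition H1loc (p : R) f : Prop :=
  Lploc p setT f /\
  forall i, exists2 g, is_wpartial setT i f g & Lploc p setT g.

(* row-wise divergence of the matrix field B, also written nabla B *)
Definition mxdiv (B : E -> 'M[R]_d) (x : E) : E :=
  \row_i \sum_j wpartial setT j (fun y => B y i j) x.

End calculus.

Section coefficients.
Context {R : realType} {d : nat}.
Local Notation E := 'rV[R]_d.
Local Notation leb := (@lebesgue_rV R d).
Variables (p : R) (A C : E -> 'M[R]_d) (H : E -> E).

Record assumption_a : Prop := {
  A_symmetric : forall x i j, A x j i = A x i j ;
  A_regular : forall i j, H1loc 2 (fun x => A x i j) /\
                          continuous (fun x => A x i j) ;
  A_elliptic : forall V : set E, precompact V ->
    exists2 nu : R, 0 < nu & forall (xi x : E), V x ->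
      nu^-1 * enorm xi ^+ 2 <= dot (mxv (A x) xi) xi <= nu * enorm xi ^+ 2 ;
  C_antisymmetric : forall x i j, - C x j i = C x i j ;
  C_regular : forall i j, H1loc 2 (fun x => C x i j) /\
                          continuous (fun x => C x i j) ;
  H_Lploc : forall i, Lploc p setT (fun x => H x 0 i) }.

Definition drift (x : E) : E :=
  2^-1 *: mxdiv (fun y => A y + (C y)^T) x + H x.

Definition assumption_b : Prop :=
  forall i, Lploc (p * d%:R / (p + d%:R)) setT (fun x => drift x 0 i).

Definition Lop (f : E -> R) (x : E) : R :=
  2^-1 * (\sum_i \sum_j A x i j * partial i (partial j f) x) +
  \sum_i drift x 0 i * partial i f x.

Record invariant_density (rho : E -> R) (mu : {measure set E -> \bar R})
    : Prop := {
  rho_H1loc : H1loc p rho ;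
  rho_continuous : continuous rho ;
  rho_gt0 : forall x, 0 < rho x ;
  mu_density : forall B : set E, measurable B ->
    mu B = (\int[leb]_(x in B) (rho x)%:E)%E ;
  mu_invariant : forall f, test_fun setT f ->
    (\int[mu]_x (Lop f x)%:E = 0)%E }.

Definition log_drift (rho : E -> R) (x : E) : E :=
  \row_i (2^-1 * \sum_j (wpartial setT j (fun y => A y i j) x +
                         A x i j * (wpartial setT j rho x / rho x))).

Definition Bdrift (rho : E -> R) (x : E) : E := drift x - log_drift rho x.

End coefficients.

(* Elements of L^s(V, mu) are represented by functions on R^d, considered on V
   only; operators on L^s(V, mu) act on such representatives. *)
Section L1_semigroups.
Context {R : realType} {d : nat}.
Local Notation E := 'rV[R]_d.
Local Notation op := ((E -> R) -> E -> R).
Variable mu : {measure set E -> \bar R}.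
Implicit Types (V : set E) (s : \bar R) (f u w : E -> R).

Definition LnormV V s f : \bar R := ('N[mu]_s [EFin \o (f \_ V)])%E.

Definition inLp V s f : Prop :=
  measurable_fun V f /\ (LnormV V s f < +oo)%E.

Definition cvgLp V s (fn : nat -> E -> R) f : Prop :=
  LnormV V s (fun x => fn n x - f x) @[n --> \oo] --> 0%E.

Record sub_markovian_C0_semigroup V (T : R -> op) : Prop := {
  semigroup_L1 : forall t f, 0 < t -> inLp V 1 f -> inLp V 1 (T t f) ;
  semigroup_linear : forall t (c : R) f g, 0 < t -> inLp V 1 f -> inLp V 1 g ->
    {ae mu, forall x, V x ->
      T t (fun y => c * f y + g y) x = c * T t f x + T t g x} ;
  semigroup_add : forall r t f, 0 < r -> 0 < t -> inLp V 1 f ->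
    {ae mu, forall x, V x -> T (r + t) f x = T r (T t f) x} ;
  semigroup_contraction : forall t f, 0 < t -> inLp V 1 f ->
    (LnormV V 1 (T t f) <= LnormV V 1 f)%E ;
  semigroup_continuous : forall f, inLp V 1 f ->
    LnormV V 1 (fun x => T t f x - f x) @[t --> 0^'+] --> 0%E ;
  semigroup_sub_markovian : forall t f, 0 < t -> inLp V 1 f ->
    {ae mu, forall x, V x -> 0 <= f x <= 1} ->
    {ae mu, forall x, V x -> 0 <= T t f x <= 1} }.

(* graph of the generator of T *)
Definition generator V (T : R -> op) u w : Prop :=
  [/\ inLp V 1 u, inLp V 1 w &
      LnormV V 1 (fun x => t^-1 * (T t u x - u x) - w x) @[t --> 0^'+]
        --> 0%E].

(* G alpha = (alpha - generator)^-1 *)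
Definition resolvent_of V (T G : R -> op) : Prop :=
  forall (alpha : R) f, 0 < alpha -> inLp V 1 f ->
    generator V T (G alpha f) (fun x => alpha * G alpha f x - f x).

End L1_semigroups.

Section semigroup.
Context {R : realType} {d : nat}.
Local Notation E := 'rV[R]_d.
Local Notation op := ((E -> R) -> E -> R).
Variables (A C : E -> 'M[R]_d) (H : E -> E) (rho : E -> R).
Variable mu : {measure set E -> \bar R}.
Implicit Types (V : set E) (f u v w : E -> R).

Definition form V u v : R :=
  2^-1 * \int[mu]_(x in V) dot (mxv (A x) (grad u x)) (grad v x).

Definition form_approx V u (un : nat -> E -> R) : Prop :=
  [/\ forall n, test_fun V (un n),
      cvgLp mu V 2%:E un u &
      forall e : R, 0 < e -> exists N, forall n m, (N <= n)%N -> (N <= m)%N ->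
        form V (un n \- un m) (un n \- un m) < e].

Definition form_domain V u : Prop :=
  inLp mu V 2%:E u /\ exists un, form_approx V u un.

(* the closure of the form takes the value e at (u, v) *)
Definition closed_form V u v (e : R) : Prop :=
  exists un vn, [/\ form_approx V u un, form_approx V v vn &
    form V (un n) (vn n) @[n --> \oo] --> e].

(* graph of L^{0,V} *)
Definition L0 V u w : Prop :=
  [/\ form_domain V u, inLp mu V 2%:E w &
      forall v, form_domain V v ->
        closed_form V u v (- \int[mu]_(x in V) (w x * v x))].

(* graph of u |-> L^{0,V} u + <B, grad u> on bounded u in D(L^{0,V}) *)
Definition L0B V u w : Prop :=
  inLp mu V +oo%E u /\
  exists2 w0, L0 V u w0 &
    forall x, w x = w0 x + dot (Bdrift A C H rho x) (wgrad V u x).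

(* graph of its closure in L^1(V, mu) *)
Definition Lbar V u w : Prop :=
  [/\ inLp mu V 1%E u, inLp mu V 1%E w &
      exists un wn, [/\ forall n, L0B V (un n) (wn n),
        cvgLp mu V 1%E un u & cvgLp mu V 1%E wn w]].

(* closability of L0B is part of this: the graph of a generator is functional
   up to null sets *)
Definition local_resolvent V (G : R -> op) : Prop :=
  exists T : R -> op, [/\ sub_markovian_C0_semigroup mu V T,
    forall u w, generator mu V T u w <-> Lbar V u w &
    resolvent_of mu V T G].

Definition exhaustion (Vn : nat -> set E) : Prop :=
  [/\ forall n, open (Vn n) /\ precompact (Vn n),
      forall n, Vn n `<=` Vn n.+1 & \bigcup_n Vn n = setT].

Definition global_resolvent (G : R -> op) : Prop :=
  exists2 GV : set E -> R -> op,
    forall V, open V -> precompact V -> local_resolvent V (GV V) &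
    forall (alpha : R) f, 0 < alpha -> inLp mu setT 1%E f ->
      inLp mu setT 1%E (G alpha f) /\
      forall Vn, exhaustion Vn ->
        cvgLp mu setT 1%E
          (fun n => GV (Vn n) alpha (f \_ (Vn n)) \_ (Vn n)) (G alpha f).

Record L1_semigroup (T : R -> op) : Prop := {
  L1_semigroup_C0 : sub_markovian_C0_semigroup mu setT T ;
  L1_semigroup_resolvent :
    exists2 G, global_resolvent G & resolvent_of mu setT T G ;
  L1_semigroup_extends : forall f, test_fun setT f ->
    generator mu setT T f (Lop A C H f) }.

End semigroup.

Section transition.
Context {R : realType} {d : nat}.
Local Notation E := 'rV[R]_d.
Local Notation op := ((E -> R) -> E -> R).
Variables (mu : {measure set E -> \bar R}) (T : R -> op).
Implicit Types (s : \bar R) (f g h : E -> R).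

Definition L1Loo f : Prop := inLp mu setT 1%E f /\ inLp mu setT +oo%E f.

(* L^1 /\ L^oo is not dense in L^oo, where T_t is extended along bounded
   increasing sequences of nonnegative functions. *)
Definition extends_pos (t : R) h g : Prop :=
  forall fn : nat -> E -> R,
    (forall n, L1Loo (fn n)) ->
    (forall n x, 0 <= fn n x <= fn n.+1 x) ->
    (forall x, fn n x @[n --> \oo] --> h x) ->
    {ae mu, forall x, T t (fn n) x @[n --> \oo] --> g x}.

(* T_t f = g in L^s(R^d, mu) *)
Definition Ls_semigroup s (t : R) f g : Prop :=
  inLp mu setT s g /\
  if s == +oo%E then
    exists g1 g2, [/\ extends_pos t (fun x => Num.max (f x) 0) g1,
      extends_pos t (fun x => Num.max (- f x) 0) g2 &
      {ae mu, forall x, g x = g1 x - g2 x}]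
  else
    forall fn : nat -> E -> R, (forall n, L1Loo (fn n)) ->
      cvgLp mu setT s fn f -> cvgLp mu setT s (fun n => T t (fn n)) g.

Definition transition_function (P : R -> op) : Prop :=
  (forall f, P 0 f = f) /\
  forall s (t : R) f, (1 <= s)%E -> 0 < t -> inLp mu setT s f ->
    continuous (P t f) /\ Ls_semigroup s t f (P t f).

End transition.

(* The state space with cemetery is [one_point_compactification 'rV[R]_d], an
   alias of [option 'rV[R]_d]; the cemetery Delta is [None]. *)
Section process.
Context {R : realType} {d : nat} {dO : measure_display}.
Context {Omega : measurableType dO}.
Local Notation E := 'rV[R]_d.
Local Notation S := (one_point_compactification 'rV[R]_d).
Variables (Pr : S -> probability Omega R) (F : R -> set (set Omega)).
Variable X : R -> Omega -> S.
Implicit Types (r s t : R) (B : set S) (w : Omega).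

(* X_t for t in [0, +oo], with X_oo = Delta *)
Definition Xe (t : \bar R) (w : Omega) : S :=
  if t is t'%:E then X t' w else None.

Definition stopping_time (sigma : Omega -> \bar R) : Prop :=
  (forall w, (0 <= sigma w)%E) /\
  forall t, 0 <= t -> F t [set w | (sigma w <= t%:E)%E].

Definition stopped_events (sigma : Omega -> \bar R) : set (set Omega) :=
  [set Gamma | measurable Gamma /\
     forall t, 0 <= t -> F t (Gamma `&` [set w | (sigma w <= t%:E)%E])].

Record hunt_process : Prop := {
  filtration_sigma_algebra : forall t, 0 <= t -> sigma_algebra setT (F t) ;
  filtration_measurable : forall t, 0 <= t -> F t `<=` measurable ;
  filtration_nondecreasing : forall s t, 0 <= s -> s <= t -> F s `<=` F t ;
  filtration_right_continuous : forall t, 0 <= t ->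
    \bigcap_(s in [set s | t < s]) F s `<=` F t ;
  process_adapted : forall t (B : set S), 0 <= t -> measurable B ->
    F t (X t @^-1` B) ;
  process_kernel : forall t (B : set S), 0 <= t -> measurable B ->
    measurable_fun [set: S] (fun x : S => Pr x (X t @^-1` B) : \bar R) ;
  process_normal : forall x : S, Pr x [set w | X 0 w = x] = 1%E ;
  process_absorbed : forall s t w, 0 <= s -> s <= t ->
    X s w = None -> X t w = None ;
  process_shift : forall t, 0 <= t -> exists theta : Omega -> Omega,
    forall s w, 0 <= s -> X s (theta w) = X (t + s) w ;
  process_continuous : forall w,
    {within [set t | 0 <= t], continuous (fun t => X t w)} ;
  (* P_x(X_{sigma+s} in B | F_sigma) = P_{X_sigma}(X_s in B), P_x-a.s. *)
  process_strong_markov : forall sigma, stopping_time sigma ->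
    forall (x : S) Gamma, stopped_events sigma Gamma ->
    forall (s : R) (B : set S), 0 <= s -> measurable B ->
      Pr x (Gamma `&` [set w | B (Xe (sigma w + s%:E)%E w)]) =
      (\int[Pr x]_(w in Gamma) Pr (Xe (sigma w) w) (X s @^-1` B))%E ;
  process_quasi_left_continuous : forall sigma_ : nat -> Omega -> \bar R,
    (forall n, stopping_time (sigma_ n)) ->
    (forall n w, (sigma_ n w <= sigma_ n.+1 w)%E) ->
    let sigma w := ereal_sup (range (sigma_^~ w)) in
    forall x : S, {ae Pr x, forall w, (sigma w < +oo)%E ->
      Xe (sigma_ n w) w @[n --> \oo] --> Xe (sigma w) w} }.

(* the convention f(Delta) := 0 *)
Definition at_cemetery0 (f : E -> R) (y : S) : R :=
  if y is Some x then f x else 0.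

Definition has_transition_function (P : R -> (E -> R) -> E -> R) : Prop :=
  forall t (x : E) (f : E -> R), 0 <= t ->
    measurable_fun setT f -> (exists c : R, forall y, `|f y| <= c) ->
    ((P t f x)%:E = \int[Pr (Some x)]_w (at_cemetery0 f (X t w))%:E)%E.

Definition lifetime (w : Omega) : \bar R :=
  ereal_inf [set t%:E | t in [set t | 0 <= t /\ X t w = None]].

Definition non_explosive : Prop :=
  forall x : E, Pr (Some x) [set w | lifetime w = +oo%E] = 1%E.

End process.

(* Main.v *)
Require Import Defs.
From mathcomp Require Import all_boot all_order all_algebra.
From mathcomp Require Import all_classical all_reals all_analysis.
From mathcomp Require Import measurable_realfun ess_sup_inf zify ring lra.
Import Order.TTheory GRing.Theory Num.Def Num.Theory numFieldNormedType.Exports.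
Local Open Scope classical_set_scope.
Local Open Scope ring_scope.

(* No stochastic calculus is needed.  Let [E(y) = exp(-1/y)] for [y > 0] and [0]
   otherwise, [c = E(1/2)], [k > 0] and [w = E(1/2 - k phi)].  As [phi] tends to
   infinity, [w] is a C^2 function with compact support, and since [E] is
   increasing and convex on [(-oo, 1/2]], [L phi <= M phi] gives
   [L w >= M (w - c)] almost everywhere.  Approximating [phi] by Bernstein
   polynomials in C^2 on a large cube yields [u] in C_0^oo close to [w], to which
   the generator applies; as [T_t] is positive and [T_t 1_K <= 1], Euler steps
   give [c - T_t w <= e^{Mt} (c - w)] mu-a.e.  Both sides have continuous
   versions, so [c - E_x w(X_t) <= e^{Mt} (c - w(x))] for every [x].  Here
   [c - w] is about [4 c k phi] for small [k] and [w] vanishes at the cemetery: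
   [k -> 0] gives [P_x(X_t = Delta) = 0] and the bound on [E_x phi(X_t)]. *)

Set Implicit Arguments. Unset Strict Implicit. Unset Printing Implicit Defensive.

(** * C^k functions and flat functions *)

(** The generator is known only on $C_0^\infty$, while [phi] is unbounded and merely $C^2$. The
    truncation has to be compactly supported and still inherit a differential inequality. The
    constant 1/2 comes from $E''(y)=(y^{-4}-2y^{-3})e^{-1/y}$ for $y>0$, which is nonnegative
    exactly up to $y=1/2$: there the second-order term of $Lw$ has a sign by ellipticity, and the
    tangent inequality $E'(y)(1/2-y)\le c-E(y)$ at $y=1/2-k\varphi$ bounds $-kE'(y)L\varphi$ below
    by $-M(c-w)$. Approximating [phi] and then applying $E$, instead of approximating $w$, keeps the
    support compact, because $E$ vanishes identically on $(-\infty,0]$. Two further obstacles: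
    constants need not be $\mu$-integrable, so under the semigroup $c$ is replaced by $c1_K$; and
    the drift is only locally integrable, so closeness in $C^2$ makes $Lu$ close to $Lw$ in $L^1$
    only. Errors are therefore carried as nonnegative functions with small integral and discarded by
    an almost everywhere comparison at the end. *)

Section line.
Context {R : realType} {V : normedModType R}.
Implicit Types (f : V -> R) (x v : V).

(** The two difference quotients coincide, so the one-variable chain rule and mean value theorem
    become available for directional derivatives. *)
Lemma is_derive_lineP f x v (df : R) :
  is_derive x v f df <-> is_derive (0 : R) 1 (fun h : R => f (h *: v + x)) df.
Proof.
have E : 'D_v f x = 'D_1 (fun h : R => f (h *: v + x)) 0.
  rewrite /derive; set g1 := fun h => h^-1 *: _; set g2 := fun h => h^-1 *: _.
  suff -> : g1 = g2 by [].
  by apply/funext => h; rewrite /g1 /g2 /= addr0 scale0r add0r [_%:A]mulr1.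
split=> -[dfx <-].
- by split; [exact: (derivable1P _ _ _).1|rewrite -E].
- by split; [exact: (derivable1P _ _ _).2|rewrite E].
Qed.

End line.

Section chain_rule.
Context {R : realType} {V : normedModType R}.
Implicit Types (f : V -> R) (x v : V).

Lemma is_derive_line f x v (s df : R) :
  is_derive (s *: v + x) v f df ->
  is_derive s 1 (fun h : R => f (h *: v + x)) df.
Proof.
move=> /is_derive_lineP H.
apply: (@is_derive_lineP R R (fun h : R => f (h *: v + x)) s 1 df).2.
have -> : (fun h : R => f ((h *: 1 + s) *: v + x)) =
          (fun h : R => f (h *: v + (s *: v + x))).
  by apply/funext => h; rewrite [_%:A]mulr1 scalerDl addrA.
exact: H.
Qed.

Lemma is_derive_comp f (g : R -> R) x v (df dg : R) :
  is_derive x v f df -> is_derive (f x) 1 g dg ->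
  is_derive x v (g \o f) (dg * df).
Proof.
move=> /is_derive_lineP fx gx; apply/is_derive_lineP.
have := @is_derive1_comp R g (fun h : R => f (h *: v + x)) 0 dg df.
by rewrite scale0r add0r; exact.
Qed.

End chain_rule.

Lemma near_eq_continuous_at (R : realType) (T : topologicalType)
    (f g : T -> R) (x : T) :
  (\forall y \near x, f y = g y) -> {for x, continuous g} ->
  {for x, continuous f}.
Proof.
move=> fg cg; rewrite /prop_for/continuous_at (nbhs_singleton fg).
apply: cvg_trans cg; apply: near_eq_cvg.
by move: fg; apply: filterS => y ->.
Qed.

Section Ck_theory.
Context {R : realType} {d : nat}.
Local Notation E := 'rV[R]_d.
Implicit Types (f g : E -> R) (i : 'I_d) (k : nat).

Definition smooth f := forall k, Ck k f.

Lemma Ck_continuous k f : Ck k f -> continuous f.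
Proof. by case: k => [//|k []]. Qed.

Lemma CkS k f : Ck k.+1 f -> Ck k f.
Proof.
elim: k f => [f []//|k ih f [cf df]]; split=> // i.
by have [? /ih] := df i; split.
Qed.

Lemma Ck_is_derive k f i (x : E) : Ck k.+1 f ->
  is_derive x (delta_mx 0 i) f (partial i f x).
Proof. by move=> [_ /(_ i)[/(_ x) /derivableP]]. Qed.

Lemma CkSP k f (f' : 'I_d -> E -> R) : continuous f ->
  (forall i x, is_derive x (delta_mx 0 i) f (f' i x)) ->
  (forall i, Ck k (f' i)) -> Ck k.+1 f.
Proof.
move=> cf df kf; split=> // i; split=> [x|].
  by have [] := df i x.
have -> : partial i f = f' i by apply/funext => x; have [] := df i x.
exact: kf.
Qed.

Lemma partialE f i (x : E) (df : R) :
  is_derive x (delta_mx 0 i) f df -> partial i f x = df.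
Proof. by move=> []. Qed.

Lemma Ck_cst k (c : R) : Ck k (cst c : E -> R).
Proof.
elim: k c => [|k ih] c; first exact: cst_continuous.
apply: (@CkSP _ _ (fun _ => cst 0)); first exact: cst_continuous.
by move=> i; exact: ih.
Qed.

Lemma continuous_add f g :
  continuous f -> continuous g -> continuous (f \+ g).
Proof.
by move=> cf cg x; change (continuous_at x (f + g)); exact (continuousD (cf x)
  (cg x)).
Qed.

Lemma continuous_mul f g :
  continuous f -> continuous g -> continuous (f \* g).
Proof. by move=> cf cg x; exact (continuousM (cf x) (cg x)). Qed.

Lemma continuous_affine (a b : R) f :
  continuous f -> continuous (fun x => a + b * f x).
Proof.
move=> cf; apply: (@continuous_add (cst a) (cst b \* f)).
  exact: cst_continuous.
by apply: continuous_mul => //; exact: cst_continuous.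
Qed.

Lemma CkD k f g : Ck k f -> Ck k g -> Ck k (f \+ g).
Proof.
elim: k f g => [|k ih] f g Hf Hg.
  exact: (continuous_add (Ck_continuous Hf) (Ck_continuous Hg)).
apply: (@CkSP _ _ (fun i => partial i f \+ partial i g)).
- exact: (continuous_add (Ck_continuous Hf) (Ck_continuous Hg)).
- by move=> i x; exact: (is_deriveD (Ck_is_derive i x Hf) (Ck_is_derive i x
    Hg)).
- by move=> i; apply: ih; [apply: (Hf.2 i).2|apply: (Hg.2 i).2].
Qed.

Lemma CkM k f g : Ck k f -> Ck k g -> Ck k (f \* g).
Proof.
elim: k f g => [|k ih] f g Hf Hg.
  exact: (continuous_mul (Ck_continuous Hf) (Ck_continuous Hg)).
apply: (@CkSP _ _ (fun i => (f \* partial i g) \+ (g \* partial i f))).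
- exact: (continuous_mul (Ck_continuous Hf) (Ck_continuous Hg)).
- by move=> i x; exact: (is_deriveM (Ck_is_derive i x Hf) (Ck_is_derive i x
    Hg)).
- by move=> i; apply: CkD; apply: ih;
    [exact: CkS|apply: (Hg.2 i).2|exact: CkS|apply: (Hf.2 i).2].
Qed.

(** Serves functions glued from smooth pieces. The equality with [g] near [x] also holds near every
    point close to [x], so the partial derivatives agree near [x] too and the induction applies to
    them. *)
Lemma Ck_local k f :
  (forall x : E, exists2 g, Ck k g & \forall y \near x, f y = g y) -> Ck k f.
Proof.
elim: k f => [|k ih] f H.
  suff : continuous f by [].
  move=> x; have [g cg fg] := H x.
  have cg' : continuous g := cg.
  exact: (near_eq_continuous_at fg (cg' x)).
have dH i (x : E) : exists2 g', Ck k g' &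
   (is_derive x (delta_mx 0 i) f (g' x) /\ \forall y \near x, partial i f y =
     g' y).
  have [g gk fg] := H x; exists (partial i g); first exact: (gk.2 i).2.
  have P (y : E) : (\near y, f y = g y) -> is_derive y (delta_mx 0 i) f
    (partial i g y).
    move=> fgy; apply: (@near_eq_is_derive _ _ _ g).
      by move: fgy; apply: filterS => z ->.
    exact: Ck_is_derive gk.
  split; first exact: P.
  move/nbhs_interior: fg; apply: filterS => y fgy.
  by apply: partialE; exact: P.
split.
  suff : continuous f by [].
  move=> x; have [g gk fg] := H x.
  have cg : continuous g := Ck_continuous gk.
  exact: (near_eq_continuous_at fg (cg x)).
move=> i; split=> [x|]; first by have [g' _ [[]]] := dH i x.
by apply: ih => x; have [g' kg' [_ ?]] := dH i x; exists g'.
Qed.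

(** The derivative of [g \o f] is [g' \o f] times a smooth function, and [g'] stays in the class, so
    induction on the order closes. The class in view is the range of [flat]. *)
Lemma smooth_comp (S : set (R -> R)) (f : E -> R) :
  (forall g : R -> R, S g -> exists2 g', S g' & forall y : R, is_derive y 1 g
    (g' y)) ->
  smooth f -> forall g : R -> R, S g -> smooth (g \o f).
Proof.
move=> HS fs g Sg k; elim: k g Sg => [|k ih] g Sg; have [g' Sg' gg'] := HS _ Sg.
  move=> x; apply: continuous_comp; first exact: (fs 0%N).
  by apply/differentiable_continuous/derivable1_diffP; have [] := gg' (f x).
have cg : continuous g.
  by move=> y; apply/differentiable_continuous/derivable1_diffP; have [] := gg'
    y.
apply: (@CkSP _ _ (fun i => (g' \o f) \* partial i f)).
- by move=> x; apply: continuous_comp; [exact: (fs 0%N)|exact: cg].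
- by move=> i x; apply: is_derive_comp; exact: (@Ck_is_derive 0).
- by move=> i; apply: CkM; [exact: ih|exact: ((fs k.+1).2 i).2].
Qed.

End Ck_theory.

(* [flat P] is [P(1/y) exp(-1/y)] for [y > 0], extended by [0]. This class of
   functions is stable under differentiation. *)
Section flat_functions.
Context {R : realType}.
Implicit Types P : {poly R}.

Definition flat P (y : R) : R :=
  if 0 < y then P.[y^-1] * expR (- y^-1) else 0.

(** From $\frac{d}{dy}\bigl(P(1/y)e^{-1/y}\bigr)=y^{-2}\bigl(P(1/y)-P'(1/y)\bigr)e^{-1/y}$. *)
Definition dflat P : {poly R} := 'X^2 * (P - P^`()).

Lemma exprn_le_expR n (x : R) : 0 <= x -> x ^+ n <= n`!%:R * expR x.
Proof.
case: n => [|n] x0; first by rewrite expr0 mul1r -expR0 ler_expR.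
have f0 : (0 : R) < n.+1`!%:R by rewrite ltr0n fact_gt0.
rewrite -ler_pdivrMl// mulrC; apply: le_trans (expR_ge1Dxn n x0).
by rewrite lerDr.
Qed.

Lemma horner_le_expR P : exists2 K : R, 0 < K &
  forall x, 0 <= x -> `|P.[x]| <= K * expR x.
Proof.
suff [K K0 HK] : exists2 K : R, 0 <= K &
    forall x, 0 <= x -> `|P.[x]| <= K * expR x.
  exists (K + 1); first by rewrite ltr_wpDl.
  move=> x /HK /le_trans; apply; rewrite ler_wpM2r ?expR_ge0//.
  by rewrite lerDl.
exists (\sum_(i < size P) `|P`_i| * i`!%:R).
  by apply: sumr_ge0 => i _; rewrite mulr_ge0.
move=> x x0; rewrite horner_coef; apply: le_trans (ler_norm_sum _ _ _) _.
rewrite mulr_suml; apply: ler_sum => i _.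
rewrite normrM (ger0_norm (exprn_ge0 _ x0)) -mulrA ler_wpM2l//.
exact: exprn_le_expR.
Qed.

(** The factor ['X^2] added to [P] buys the bound $Ky^2$; this makes the difference quotient at 0 at
    most $K|h|$, hence the derivative there 0. *)
Lemma flat_le P : exists2 K : R, 0 < K & forall y, `|flat P y| <= K * y ^+ 2.
Proof.
have [K K0 HK] := horner_le_expR (P * 'X^2).
exists K => // y; rewrite /flat; case: ifPn => y0; last first.
  by rewrite normr0 mulr_ge0 ?sqr_ge0// ltW.
have := HK y^-1; rewrite invr_ge0 ltW// => /(_ isT).
rewrite hornerM hornerXn normrM [X in _ * X]ger0_norm ?sqr_ge0// => H.
rewrite normrM (ger0_norm (expR_ge0 _)) expRN.
by rewrite ler_pdivrMr ?expR_gt0// mulrAC -ler_pdivrMr ?exprn_gt0// -exprVn.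
Qed.

Lemma is_derive_flat P (y : R) : is_derive y 1 (flat P) (flat (dflat P) y).
Proof.
have [y0|y0|->] := ltgtP y 0.
- have -> : flat (dflat P) y = 0 by rewrite /flat ltNge (ltW y0).
  apply: (@near_eq_is_derive _ _ _ (cst 0)).
  have : \forall z \near y, z < 0 by exact: lt_nbhsl.
  by apply: filterS => z z0; rewrite /flat ltNge (ltW z0).
- have N : \forall z \near y, P.[z^-1] * expR (- z^-1) = flat P z.
    have : \forall z \near y, 0 < z by exact: lt_nbhsr.
    by apply: filterS => z z0; rewrite /flat z0.
  apply: (near_eq_is_derive N).
  have yn0 : y != 0 by rewrite gt_eqF.
  have dV : is_derive y 1 (fun z : R => z^-1) (- y ^- 2).
    have := @is_deriveV R id y 1 1 yn0 (@is_derive_id R R y 1).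
    by move=> /is_derive_eq; apply; rewrite [_ *: _]mulr1.
  have dP : is_derive y 1 (fun z : R => P.[z^-1]) (P^`().[y^-1] * - y ^- 2).
    exact: (@is_derive1_comp R (horner P) (fun z => z^-1) y _ _
              (is_derive_poly P y^-1) dV).
  have dN : is_derive y 1 (fun z : R => - z^-1) (y ^- 2).
    by rewrite -[y ^- 2]opprK; exact: is_deriveN.
  have dE : is_derive y 1 (fun z : R => expR (- z^-1)) (expR (- y^-1) * y ^- 2).
    exact: (@is_derive1_comp R expR (fun z => - z^-1) y _ _
              (is_derive_expR (- y^-1)) dN).
  have := is_deriveM dP dE.
  rewrite /flat y0 => /is_derive_eq; apply.
  rewrite /dflat !hornerE /GRing.scale/= -exprVn; ring.
- have -> : flat (dflat P) 0 = 0 by rewrite /flat ltxx.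
  have [K K0 HK] := flat_le P.
  suff H : (fun h : R => h^-1 *: (flat P (h *: (1:R) + 0) - flat P 0)) @ 0^'
      --> (0 : R).
    split; first by apply/cvg_ex; exists 0.
    exact: cvg_lim H.
  apply/cvgr0Pnorm_le => e e0.
  have : \forall h \near (0 : R), `|h| < e / K by apply: nbhs0_lt; exact:
    divr_gt0.
  move/(@nbhs_dnbhs R 0); apply: filterS => h he.
  rewrite addr0 [h *: _]mulr1 {2}/flat ltxx subr0 normrM normfV.
  have [->|h0] := eqVneq h 0; first by rewrite normr0 invr0 mul0r ltW.
  rewrite ler_pdivrMl ?normr_gt0// (le_trans (HK h))// -real_normK ?num_real//.
  rewrite expr2 mulrCA ler_wpM2l// mulrC -ler_pdivlMr//; exact: ltW.
Qed.

End flat_functions.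

(** * C^2 approximation by Bernstein polynomials *)

Section norm_rV.
Context {R : realType} {d : nat}.
Local Notation E := 'rV[R]_d.

Lemma rV_norm_le (x : E) (r : R) : 0 <= r ->
  (`|x| <= r) = [forall i, `|x 0 i| <= r].
Proof.
move=> r0; apply/idP/forallP => [xr i|xr].
  apply: le_trans xr; rewrite [leRHS]/normr/= mx_normrE.
  exact: (le_bigmax _ (fun k : 'I_1 * 'I_d => `|x k.1 k.2|) (0, i)).
rewrite [leLHS]/normr/= mx_normrE; apply: bigmax_le => // -[i j] _ /=.
by rewrite ord1.
Qed.

Lemma rV_coord_le (x : E) i : `|x 0 i| <= `|x|.
Proof. by have := rV_norm_le x (normr_ge0 x); rewrite lexx => /esym/forallP.
  Qed.

Lemma rV_ball_compact (r : R) : compact [set x : E | `|x| <= r].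
Proof.
apply: bounded_closed_compact.
  exists r; split; first exact: num_real.
  by move=> y ry x /= xr; rewrite (le_trans xr)// ltW.
rewrite (_ : mkset _ = (@normr R E) @^-1` [set y | y <= r])//.
apply: closed_comp; last exact: closed_le.
by move=> x _; exact: norm_continuous.
Qed.

(** Only [x] is confined to [K]: the second point may be one that a finite difference has pushed out
    of the cube. *)
Lemma compact_uniformly_continuous (K : set E) (f : E -> R) : compact K ->
  continuous f -> forall e : R, 0 < e -> exists2 del : R, 0 < del &
  forall x y, K x -> `|x - y| < del -> `|f x - f y| < e.
Proof.
move=> cK cf e e0.
have /compact_near_coveringP nK := cK.
have /= H := nK R (0 : R)^'+ (fun del x => forall y, `|x - y| < del -> `|f x -
  f y| < e).
have : \forall del \near (0 : R)^'+, K `<=` (fun x => forall y, `|x - y| < del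
  -> `|f x - f y| < e).
  apply: H => x Kx.
  have /cvgrPdist_lt/(_ (e / 2)) := cf x.
  rewrite divr_gt0// => /(_ isT) /nbhs_ballP[eta /= eta0 B].
  exists ([set x' | `|x - x'| < eta / 2], [set del | del <= eta / 2]).
    split => /=.
      apply/nbhs_ballP; exists (eta / 2) => /=; first by rewrite divr_gt0.
      by move=> y; rewrite -ball_normE.
    by apply: nbhs_right_le; rewrite divr_gt0.
  move=> [x' del] /= [xx' dele] y x'y.
  have xy : `|x - y| < eta.
    rewrite (splitr eta) -(subrKA x') (le_lt_trans (ler_normD _ _))// ltrD//.
    exact: lt_le_trans dele.
  have h1 : `|f x - f x'| < e / 2.
    by apply: B; rewrite -ball_normE/=; apply: lt_trans xx' _; rewrite
      ltr_pdivrMr// ltr_pMr// ltr1n.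
  have h2 : `|f x - f y| < e / 2 by apply: B; rewrite -ball_normE/=.
  rewrite (splitr e) -(subrKA (f x)) (le_lt_trans (ler_normD _ _))// ltrD//.
  by rewrite distrC.
move=> N; near ((0 : R)^'+) => del.
have HK : K `<=` (fun x => forall y, `|x - y| < del -> `|f x - f y| < e).
  by near: del.
by exists del => // x y Kx; exact: HK.
Unshelve. all: by end_near. Qed.

Lemma compact_normr_bounded (K : set E) (f : E -> R) : compact K ->
  continuous f -> exists2 b : R, 0 < b & forall x, K x -> `|f x| <= b.
Proof.
move=> cK cf.
have : bounded_set (f @` K).
  apply: compact_bounded; apply: continuous_compact => //.
  exact: continuous_subspaceT.
move=> [M [Mr HM]]; exists (`|M| + 1); first by rewrite ltr_wpDl.
move=> x Kx; apply: (HM (`|M| + 1)); first by rewrite (le_lt_trans (ler_norm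
  M))// ltrDl.
by exists x.
Qed.

End norm_rV.

(** * Multivariate Bernstein operators as random walks *)

Section bernstein.
Context {R : realType} {d : nat}.
Local Notation E := 'rV[R]_d.
Local Notation "'e_ i" := (delta_mx 0 i : E) (at level 8, i at level 2).
Variables (r h : R).
Hypothesis r0 : 0 < r.
Implicit Types (F G : E -> R) (x s y : E) (i j : 'I_d) (l : seq 'I_d).

Definition cube_coord i x : R := (x 0 i + r) / (2 * r).

Definition bstep x i F s : R :=
  (1 - cube_coord i x) * F s + cube_coord i x * F (s + h *: 'e_i).

(* Expected value of [F] after the random walk from [s] which, for each [i] in
   [l], jumps by [h] in direction [i] with probability [cube_coord i x]; as a
   function of [x] this is a Bernstein polynomial of [F]. *)
Definition bern x l F : E -> R := foldr (bstep x) F l.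

Definition fdiff i F s : R := F (s + h *: 'e_i) - F s.

Lemma bstepC x i j F : bstep x i (bstep x j F) = bstep x j (bstep x i F).
Proof.
apply/funext => s; rewrite /bstep (addrAC s); ring.
Qed.

(** Steps commute by [bstepC], so any occurrence of [j] can be moved to the front. *)
Lemma bern_rem x j l F : j \in l -> bstep x j (bern x (rem j l) F) = bern x l F.
Proof.
elim: l => //= i l ih; rewrite in_cons; case: eqVneq => [->//|ji] /= jl.
by rewrite /= bstepC ih.
Qed.

(** The jump probabilities depend on the parameter [x] and not on the current position, so the walk
    commutes with translations. *)
Lemma bern_fdiff x i l F : fdiff i (bern x l F) = bern x l (fdiff i F).
Proof.
elim: l => //= j l <-; apply/funext => s.
rewrite /fdiff /bstep (addrAC s); ring.
Qed.

Lemma bern_lin x l (c : R) F G s :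
  bern x l (fun y => c * F y + G y) s = c * bern x l F s + bern x l G s.
Proof.
elim: l s => //= i l ih s; rewrite /bstep !ih; ring.
Qed.

Lemma bern_scale x l (c : R) F s :
  bern x l (fun y => c * F y) s = c * bern x l F s.
Proof. elim: l s => //= i l ih s; rewrite /bstep !ih; ring. Qed.

Lemma bern_cst x l (c : R) s : bern x l (fun=> c) s = c.
Proof. elim: l s => //= i l ih s; rewrite /bstep !ih; ring. Qed.

Lemma bern_sum x l (I : Type) (q : seq I) (F : I -> E -> R) s :
  bern x l (fun y => \sum_(k <- q) F k y) s = \sum_(k <- q) bern x l (F k) s.
Proof.
elim: q => [|k q ih].
  under [X in bern _ _ X]eq_fun do rewrite big_nil.
  by rewrite bern_cst big_nil.
rewrite big_cons -ih -[bern x l (F k) s]mul1r -bern_lin.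
congr (bern x l _ s); apply/funext => y.
by rewrite big_cons mul1r.
Qed.

(** Squared bias plus variance: coordinate [i] ends at [s 0 i] plus [h] times a binomial variable
    with [m] trials and success probability [cube_coord i x]. *)
Lemma bern_moment x l i (a : R) s (m := (count_mem i l)%:R : R) :
  bern x l (fun y => (y 0 i - a) ^+ 2) s =
  (s 0 i + m * h * cube_coord i x - a) ^+ 2 +
  m * h ^+ 2 * (cube_coord i x * (1 - cube_coord i x)).
Proof.
rewrite {}/m; elim: l s => [|j l ih] s /=.
  by rewrite !mul0r !addr0.
rewrite /bstep !ih !mxE eqxx /=.
have [->|ij] := eqVneq j i; rewrite natrD ?mulr1n ?mulr0n; ring.
Qed.

Lemma is_derive_cube_coord x i j :
  is_derive x 'e_j (cube_coord i) ((i == j)%:R / (2 * r)).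
Proof.
apply/is_derive_lineP.
rewrite (_ : (fun h0 => _) = cst (cube_coord i x) + ((i == j)%:R / (2 * r)) \*:
  id).
  apply: (is_derive_eq (is_deriveD (@is_derive_cst R R R (cube_coord i x) 0 1)
    (is_deriveZ ((i == j)%:R / (2 * r)) (@is_derive_id R R 0 1)))).
  by rewrite add0r [_ *: _]mulr1.
apply/funext => t; rewrite /cube_coord /= !mxE eqxx /= eq_sym.
rewrite -[RHS]/((x 0 i + r) / (2 * r) + (j == i)%:R / (2 * r) * (t : R)); ring.
Qed.

(** Each jump in direction [j] has a probability with slope $1/(2r)$ in $x_j$, and its derivative
    replaces that jump by the difference between jumping and staying. By commutation all these
    contributions are equal, so the derivative is again a Bernstein expression with one jump
    fewer. *)
Lemma is_derive_bern x j l F s :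
  is_derive x 'e_j (fun x => bern x l F s)
   ((count_mem j l)%:R / (2 * r) * bern x (rem j l) (fdiff j F) s).
Proof.
elim: l s => [|i l ih] s.
  by rewrite mul0r mul0r; exact: is_derive_cst.
have D1 := is_deriveM (is_derive_cube_coord x i j) (ih s).
have D2 := is_deriveM (is_derive_cube_coord x i j) (ih (s + h *: 'e_i)).
have D3 := is_deriveD (is_deriveB (ih s) D1) D2.
rewrite (_ : (fun x => _) = (fun x => bern x l F s) -
  cube_coord i * (fun x => bern x l F s) +
  cube_coord i * (fun x => bern x l F (s + h *: 'e_i))); last first.
  by apply/funext => y /=; rewrite /bstep mulrBl mul1r.
apply: (is_derive_eq D3); rewrite /GRing.scale/=.
have [->|ij] := eqVneq i j; last first.
  rewrite mul0r !mulr0 !addr0 /= /bstep add0n; ring.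
set c := (count_mem j l)%:R; set B := bern x (rem j l) (fdiff j F).
have K2 : bern x l (fdiff j F) s =
    bern x l F (s + h *: 'e_j) - bern x l F s by rewrite -bern_fdiff.
have K1 : c * ((1 - cube_coord j x) * B s + cube_coord j x * B (s + h *: 'e_j))
  =
    c * bern x l (fdiff j F) s.
  (* If [j] does not occur in [l], then [c] is 0 and there is nothing to put back. *)
  have [jl|/count_memPn jl] := boolP (j \in l); last by rewrite /c jl !mul0r.
  by rewrite -(bern_rem x (fdiff j F) jl).
have K3 : (1 + c) / (2 * r) * bern x l (fdiff j F) s =
    (2 * r)^-1 * bern x l (fdiff j F) s +
    (c * bern x l (fdiff j F) s) / (2 * r) by ring.
rewrite /= natrD K3 -K1 K2; ring.
Qed.

Lemma smooth_cube_coord i : smooth (cube_coord i).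
Proof.
move=> k; suff : Ck k.+1 (cube_coord i) by exact: CkS.
apply: (@CkSP _ _ _ _ (fun j => cst ((i == j)%:R / (2 * r)))).
- move=> x; apply: differentiable_continuous.
  apply: (@differentiableM _ _ (fun x : E => x 0 i + r) (cst (2 * r)^-1)) => //.
  by apply: differentiableD => //; exact: differentiable_coord.
- by move=> j x; exact: is_derive_cube_coord.
- by move=> j; exact: Ck_cst.
Qed.

Lemma smooth_bern l F s : smooth (fun x => bern x l F s).
Proof.
move=> k; elim: l s => [|i l ih] s /=; first exact: Ck_cst.
have cN : Ck k (fun x => 1 - cube_coord i x).
  rewrite (_ : (fun x => _) = cst 1 \+ (cst (-1) \* cube_coord i)).
    by apply: CkD; [exact: Ck_cst|apply: CkM; [exact: Ck_cst|exact:
      smooth_cube_coord]].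
  by apply/funext => x /=; rewrite mulN1r.
apply: (CkD (CkM cN (ih s))).
by apply: CkM; [exact: smooth_cube_coord|exact: ih].
Qed.

(** The comparison is asked only on the box that the walk can reach from [s]; in [bern_cvg] this box
    lies in the cube, outside of which nothing is assumed on [F']. *)
Lemma bern_le x l F G s : (forall i, 0 <= cube_coord i x <= 1) -> 0 <= h ->
  (forall y, (forall i, s 0 i <= y 0 i <= s 0 i + (count_mem i l)%:R * h) ->
    F y <= G y) ->
  bern x l F s <= bern x l G s.
Proof.
move=> x01 h0; elim: l s => [|j l ih] s FG /=.
  by apply: FG => i; rewrite mul0r addr0 lexx.
have /andP[xj0 xj1] := x01 j.
apply: lerD; apply: ler_wpM2l; rewrite ?subr_ge0//; apply: ih => y ys;
  apply: FG => i; have /andP[ys1 ys2] := ys i.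
  rewrite ys1 (le_trans ys2)//= lerD2l ler_wpM2r// ler_nat leq_addl//.
move: ys1 ys2; rewrite !mxE eqxx/= eq_sym natrD mulrDl.
rewrite [h * _]mulrC addrA => ys1 ys2; rewrite ys2 andbT.
by apply: le_trans ys1; rewrite lerDl mulr_ge0.
Qed.

End bernstein.

(** * Uniform convergence of Bernstein operators *)

Section bernstein_convergence.
Context {R : realType} {d : nat}.
Local Notation E := 'rV[R]_d.
Local Notation "'e_ i" := (delta_mx 0 i : E) (at level 8, i at level 2).
Variables (r : R).
Hypothesis r0 : 0 < r.
Implicit Types (F G : E -> R) (x s y : E) (i j : 'I_d) (l : seq 'I_d).

Let corner : E := const_mx (- r).

Lemma cube_coord01 x i : `|x| <= r -> 0 <= cube_coord r i x <= 1.
Proof.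
move=> xr; have := le_trans (rV_coord_le x i) xr; rewrite ler_norml => /andP[x1
  x2].
rewrite /cube_coord divr_ge0 ?mulr_ge0// ?(ltW r0)//=; last by rewrite -lerBlDr
  sub0r.
by rewrite ler_pdivrMr ?mulr_gt0// mul1r mulr_natl mulr2n lerD2r.
Qed.

(** With $m$ between $n-2$ and $n$ jumps of size $2r/n$, the bias is at most $4r/n$ and the variance
    at most $r^2/n$, so the moment is at most $16r^2/n^2+r^2/n$. The slack of 2 accommodates the
    jumps lost in two differentiations. *)
Lemma bern_moment_le n x l i : (0 < n)%N -> `|x| <= r ->
  (n <= count_mem i l + 2)%N -> (count_mem i l <= n)%N ->
  bern r (2 * r / n%:R) x l (fun y => (y 0 i - x 0 i) ^+ 2) corner <=
  17 * r ^+ 2 / n%:R.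
Proof.
move=> n0 xr; set m := count_mem i l => nm mn.
rewrite bern_moment// mxE -/m; have := cube_coord01 i xr.
have -> : x 0 i = 2 * r * cube_coord r i x - r.
  by rewrite /cube_coord; field; rewrite gt_eqF.
set t := cube_coord _ _ _ => /andP[t0 t1].
have n0' : (0 : R) < n%:R by rewrite ltr0n.
have n1' : (1 : R) <= n%:R by rewrite ler1n.
have mn' : m%:R <= n%:R :> R by rewrite ler_nat.
have nm' : n%:R <= m%:R + 2 :> R by rewrite -natrD ler_nat.
have m0' : (0 : R) <= m%:R by rewrite ler0n.
rewrite ler_pdivlMr//.
set N : R := n%:R in n0' n1' mn' nm' *; set k : R := m%:R in mn' nm' m0' *.
have -> : ((- r + k * (2 * r / N) * t - (2 * r * t - r)) ^+ 2 +
  k * (2 * r / N) ^+ 2 * (t * (1 - t))) * N =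
  r ^+ 2 * (4 * (t * t) * ((N - k) ^+ 2 / N) + 4 * (k / N) * (t * (1 - t))).
  by field; rewrite gt_eqF.
rewrite [leRHS]mulrC; apply: ler_wpM2l; first exact: sqr_ge0.
have h1 : (N - k) ^+ 2 / N <= 4.
  by rewrite ler_pdivrMr//; nra.
have h1' : 0 <= (N - k) ^+ 2 / N by rewrite divr_ge0 ?sqr_ge0// ltW.
have h2 : k / N <= 1 by rewrite ler_pdivrMr// mul1r.
have h2' : 0 <= k / N by rewrite divr_ge0// ltW.
have h3 : t * t <= 1 by nra.
have h4 : t * (1 - t) <= 4^-1 by have := sqr_ge0 (t - 2^-1); nra.
have h4' : 0 <= t * (1 - t) by rewrite mulr_ge0// subr_ge0.
have h5 : t * t * ((N - k) ^+ 2 / N) <= 4 by rewrite -[4]mul1r ler_pM//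
  mulr_ge0.
have h6 : k / N * (t * (1 - t)) <= 4^-1 by rewrite -[4^-1]mul1r ler_pM.
lra.
Qed.

(** Chebyshev's argument: $|F(y)-F(x)|\le e+K|y-x|_2^2$ with $K=2b/\delta^2$, by uniform continuity
    for $|y-x|<\delta$ and by $|F|\le b$ otherwise; the walk is then averaged. The operand [F'] may
    differ from [F] by [e], because for derivatives it is a difference quotient that varies with
    [n]. The three errors [e] come from [F'], from uniform continuity and from the moments. *)
Lemma bern_cvg F (e : R) : continuous F -> 0 < e ->
  exists N, forall n, (N <= n)%N -> forall l,
    (forall i, (n <= count_mem i l + 2)%N /\ (count_mem i l <= n)%N) ->
    forall F', (forall y, `|y| <= r -> `|F' y - F y| <= e) ->
    forall x, `|x| <= r ->
    `|bern r (2 * r / n%:R) x l F' corner - F x| <= 3 * e.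
Proof.
move=> cF e0; have cK := @rV_ball_compact R d r.
have [del del0 Hdel] := compact_uniformly_continuous cK cF e0.
have [b b0 Hb] := compact_normr_bounded cK cF.
pose K := 2 * b / del ^+ 2.
have K0 : 0 < K by rewrite divr_gt0 ?mulr_gt0 ?exprn_gt0.
have [N0 HN0] : exists N0 : nat, K * (d%:R * (17 * r ^+ 2)) / e < N0%:R.
  exists (Num.bound (K * (d%:R * (17 * r ^+ 2)) / e)); apply: archi_boundP.
  apply: divr_ge0; last exact: ltW.
  apply: mulr_ge0; first exact: ltW.
  by apply: mulr_ge0; [exact: ler0n|apply: mulr_ge0; [exact: ler0n|exact:
    sqr_ge0]].
exists N0.+1 => n Nn l Hl F' FF' x xr.
have n0 : (0 < n)%N by exact: leq_trans Nn.
have n0' : (0 : R) < n%:R by rewrite ltr0n.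
have moments_small : K * \sum_i bern r (2 * r / n%:R) x l
    (fun y => (y 0 i - x 0 i) ^+ 2) corner <= e.
  apply: (@le_trans _ _ (K * (d%:R * (17 * r ^+ 2 / n%:R)))).
    apply: ler_wpM2l; first exact: ltW.
    apply: (@le_trans _ _ (\sum_(i < d) 17 * r ^+ 2 / n%:R)).
      apply: ler_sum => i _; have [] := Hl i; exact: bern_moment_le.
    by rewrite sumr_const card_ord -[leLHS]mulr_natl.
  have -> : K * (d%:R * (17 * r ^+ 2 / n%:R)) =
      K * (d%:R * (17 * r ^+ 2)) / e * e / n%:R by field; rewrite !gt_eqF.
  rewrite ler_pdivrMr// [leRHS]mulrC; apply: ler_wpM2r; first exact: ltW.
  apply/ltW/(lt_le_trans HN0); rewrite ler_nat; exact: ltnW.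
have est y : `|y| <= r ->
    `|F' y - F x| <= K * (\sum_i (y 0 i - x 0 i) ^+ 2) + 2 * e.
  move=> yr; have S0 : 0 <= \sum_i (y 0 i - x 0 i) ^+ 2.
    by apply: sumr_ge0 => i _; exact: sqr_ge0.
  rewrite -(subrKA (F y)) (le_trans (ler_normD _ _))//.
  have := FF' y yr.
  suff : `|F y - F x| <= K * (\sum_i (y 0 i - x 0 i) ^+ 2) + e by lra.
  have [yx|] := ltP `|y - x| del.
    rewrite (le_trans (ltW (Hdel _ _ yr yx)))// lerDr mulr_ge0// ltW//.
  move=> delyx; have [i yi] : exists i, del <= `|y 0 i - x 0 i|.
    have /mx_norm_neq0[[k i] yxi] : mx_norm (y - x) != 0.
      by rewrite gt_eqF// (lt_le_trans del0).
    exists i; move: delyx; rewrite [leRHS]/normr/= yxi/= !mxE.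
    by rewrite (ord1 k).
  have b2 : `|F y - F x| <= 2 * b.
    by rewrite (le_trans (ler_normB _ _))// mulr_natl mulr2n lerD// Hb.
  apply: (le_trans b2); rewrite ler_wpDr ?(ltW e0)//.
  rewrite /K mulrAC ler_pdivlMr ?exprn_gt0// ler_wpM2l ?mulr_ge0// ?(ltW b0)//.
  apply: (@le_trans _ _ ((y 0 i - x 0 i) ^+ 2)).
    by rewrite -[leRHS]real_normK ?num_real// lerXn2r// ?nnegrE// ltW.
  by rewrite (bigD1 i)//= lerDl sumr_ge0// => j _; exact: sqr_ge0.
have reach y : (forall i, corner 0 i <= y 0 i <=
    corner 0 i + (count_mem i l)%:R * (2 * r / n%:R)) -> `|y| <= r.
  move=> Hy; rewrite rV_norm_le ?(ltW r0)//; apply/forallP => i.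
  have := Hy i; rewrite mxE ler_norml => /andP[-> /=] /le_trans; apply.
  have : (count_mem i l)%:R * (2 * r / n%:R) <= 2 * r.
    rewrite mulrCA mulrC -ler_pdivlMr ?mulr_gt0// divff ?gt_eqF ?mulr_gt0//.
    by rewrite ler_pdivrMr// mul1r ler_nat; have [] := Hl i.
  lra.
have h0 : 0 <= 2 * r / n%:R by rewrite divr_ge0 ?mulr_ge0// ltW.
have S c c' : bern r (2 * r / n%:R) x l
    (fun y => c * (\sum_i (y 0 i - x 0 i) ^+ 2) + c') corner =
    c * (\sum_i bern r (2 * r / n%:R) x l
    (fun y => (y 0 i - x 0 i) ^+ 2) corner) + c'.
  by rewrite (bern_lin _ _ _ _ _ _ (fun=> c')) bern_cst bern_sum.
have x01 i : 0 <= cube_coord r i x <= 1 by exact: cube_coord01.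
have up : bern r (2 * r / n%:R) x l F' corner <= bern r (2 * r / n%:R) x l
    (fun y => K * (\sum_i (y 0 i - x 0 i) ^+ 2) + (F x + 2 * e)) corner.
  apply: bern_le => // y /reach /est; rewrite ler_norml; lra.
have lo : bern r (2 * r / n%:R) x l
    (fun y => (- K) * (\sum_i (y 0 i - x 0 i) ^+ 2) + (F x - 2 * e)) corner
    <= bern r (2 * r / n%:R) x l F' corner.
  apply: bern_le => // y /reach /est; rewrite ler_norml; lra.
rewrite S in up; rewrite S mulNr in lo.
rewrite ler_norml; lra.
Qed.

End bernstein_convergence.

Lemma leq_subKn_add (k m n : nat) : (m <= k)%N -> (n <= n - m + k)%N.
Proof. lia. Qed.

(** * Simultaneous approximation of derivatives up to order two *)

Section C2_approximation.
Context {R : realType} {d : nat}.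
Local Notation E := 'rV[R]_d.
Local Notation "'e_ i" := (delta_mx 0 i : E) (at level 8, i at level 2).
Variables (r : R).
Hypothesis r0 : 0 < r.
Implicit Types (F G : E -> R) (x s y : E) (i j : 'I_d).

Lemma norm_delta_mx i : `|'e_ i| <= 1 :> R.
Proof.
rewrite rV_norm_le//; apply/forallP => j; rewrite mxE eqxx/=.
by case: eqP => _; rewrite ?normr0 ?normr1.
Qed.

Lemma fdiff_MVT F F' i s (h : R) : 0 < h ->
  (forall x, is_derive x 'e_ i F (F' x)) ->
  exists2 y, `|s - y| < h & fdiff h i F s = F' y * h.
Proof.
move=> h0 dF.
pose g t := F (t *: 'e_i + s).
have dg (t : R) : is_derive t 1 g (F' (t *: 'e_i + s)) by exact: is_derive_line.
have cg : {within `[0, h], continuous g}.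
  by apply: derivable_within_continuous => t _; have [] := dg t.
have [t] := @MVT R g (fun t => F' (t *: 'e_i + s)) 0 h h0 (fun t _ => dg t) cg.
rewrite in_itv/= => /andP[t0 th] gh; exists (t *: 'e_i + s).
  rewrite opprD addrCA subrr addr0 normrN normrZ (gtr0_norm t0).
  by rewrite (le_lt_trans _ th)// ler_piMr ?norm_delta_mx// ltW.
by move: gh; rewrite /g scale0r add0r subr0 /fdiff (addrC (h *: _)) => ->.
Qed.

Lemma near_fdiff F F' i (e : R) : continuous F' -> 0 < e ->
  (forall x, is_derive x 'e_ i F (F' x)) ->
  exists2 del : R, 0 < del & forall h, 0 < h -> h < del ->
    forall y, `|y| <= r -> `|fdiff h i F y / h - F' y| <= e.
Proof.
move=> cF e0 dF.
have [del del0 H] := compact_uniformly_continuous (@rV_ball_compact R d r) cF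
  e0.
exists del => // h h0 hdel y yr.
have [z yz ->] := fdiff_MVT y h0 dF.
by rewrite mulfK ?gt_eqF// distrC ltW// H// (lt_trans yz).
Qed.

Lemma fdiffC h i j F : fdiff h i (fdiff h j F) = fdiff h j (fdiff h i F).
Proof. by apply/funext => s; rewrite /fdiff (addrAC s); ring. Qed.

Lemma near_fdiff2 F i j (e : R) : Ck 2 F -> 0 < e ->
  exists2 del : R, 0 < del & forall h, 0 < h -> h < del ->
    forall y, `|y| <= r ->
    `|fdiff h i (fdiff h j F) y / h ^+ 2 - partial i (partial j F) y| <= e.
Proof.
move=> F2 e0.
have c2 : continuous (partial i (partial j F)).
  exact: ((F2.2 j).2.2 i).2.
have [del del0 H] := compact_uniformly_continuous (@rV_ball_compact R d r) c2
  e0.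
exists (del / 2); first by rewrite divr_gt0.
move=> h h0 hdel y yr.
(* After the swap, two applications of the mean value theorem produce $\partial_i\partial_jF$ in
   exactly this order, without symmetry of second derivatives. The intermediate point moves by less
   than [h] twice, hence [del / 2]. *)
rewrite fdiffC.
have dG x : is_derive x 'e_ j (fdiff h i F) (fdiff h i (partial j F) x).
  have D1 : is_derive x 'e_ j (fun s => F (s + h *: 'e_ i)) (partial j F (x + h
    *: 'e_i)).
    apply/is_derive_lineP.
    rewrite (_ : (fun _ => _) = (fun t => F (t *: 'e_ j + (x + h *: 'e_ i)))).
      exact: (@is_derive_lineP R E F _ _ _).1 (Ck_is_derive j (x + h *: 'e_ i)
        F2).
    by apply/funext => t; rewrite addrA.
  exact: (is_deriveB D1 (Ck_is_derive j x F2)).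
have [z yz ->] := fdiff_MVT y h0 dG.
have F2j : Ck 1 (partial j F) := (F2.2 j).2.
have [w zw ->] := fdiff_MVT z h0 (fun x => @Ck_is_derive R d 0 _ i x F2j).
rewrite -[_ * h * h]mulrA -expr2 mulfK ?expf_neq0 ?gt_eqF// distrC ltW// H//.
rewrite -(subrKA z) (le_lt_trans (ler_normD _ _))// (splitr del) ltrD//.
  exact: lt_trans yz _.
exact: lt_trans zw _.
Qed.

Lemma cvg_le_inv_nat (c del : R) : 0 < c -> 0 < del ->
  \forall n \near \oo, 0 < c / n%:R < del.
Proof.
move=> c0 del0; exists (Num.bound (c / del)).+1 => //= n Nn.
have n0 : (0 : R) < n%:R by rewrite ltr0n; exact: leq_trans Nn.
rewrite divr_gt0//= ltr_pdivrMr// mulrC -ltr_pdivrMr//.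
apply: lt_trans (archi_boundP _) _; first by rewrite divr_ge0// ltW.
by rewrite ltr_nat.
Qed.

(** By [is_derive_bern], the derivatives of a Bernstein expression of [F] are Bernstein expressions
    of the difference quotients of [F], with one or two jumps fewer, and these quotients converge
    uniformly on the cube to the derivatives of [F]. *)
Theorem C2_approx F (e : R) : Ck 2 F -> 0 < e ->
  exists2 p : E -> R, smooth p & forall x, `|x| <= r ->
  [/\ `|p x - F x| <= e, forall j, `|partial j p x - partial j F x| <= e &
   forall i j, `|partial i (partial j p) x - partial i (partial j F) x| <= e].
Proof.
move=> F2 e0.
pose corner : E := const_mx (- r).
(* With [n] jumps of size $2r/n$ in each direction, the walk from [corner] sweeps exactly the
   cube. *)
pose l n : seq 'I_d := flatten [seq nseq n i | i <- enum 'I_d].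
have cl n i : count_mem i (l n) = n.
  rewrite /l count_flatten -map_comp sumnE big_map big_enum/=.
  rewrite (bigD1 i)//= count_nseq/= eqxx mul1n big1 ?addn0// => j ji.
  by rewrite count_nseq /= (negbTE ji).
pose h n : R := 2 * r / n%:R.
pose p n x := bern r (h n) x (l n) F corner.
have e3 : 0 < e / 3 by rewrite divr_gt0.
have r20 : 0 < 2 * r by rewrite mulr_gt0.
have dp n (x : E) j : (0 < n)%N -> partial j (p n) x =
    bern r (h n) x (rem j (l n)) (fun y => (h n)^-1 * fdiff (h n) j F y) corner.
  move=> n0; rewrite (partialE (is_derive_bern r (h n) x j (l n) F corner)).
  by rewrite cl bern_scale invf_div.
have ddp n (x : E) i j : (0 < n)%N -> partial i (partial j (p n)) x =
    bern r (h n) x (rem i (rem j (l n)))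
     (fun y => (count_mem i (rem j (l n)))%:R / n%:R *
        (fdiff (h n) i (fdiff (h n) j F) y / h n ^+ 2)) corner.
  move=> n0; have n0' : (0 : R) < n%:R by rewrite ltr0n.
  rewrite (_ : partial j (p n) = fun x => bern r (h n) x (rem j (l n))
    (fun y => (h n)^-1 * fdiff (h n) j F y) corner); last first.
    by apply/funext => z; exact: dp.
  rewrite (partialE (is_derive_bern r (h n) x i _ _ corner)) -bern_scale.
  congr (bern _ _ _ _ _ _); apply/funext => y; rewrite /fdiff /h.
  by field; rewrite !gt_eqF.
have H0 : \forall n \near \oo, forall x, `|x| <= r -> `|p n x - F x| <= e.
  have [N HN] := bern_cvg r0 (Ck_continuous F2) e3.
  exists N => // n Nn x xr; have := HN n Nn (l n).
  rewrite (_ : 3 * (e / 3) = e); last by field.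
  apply => //.
    by move=> i; rewrite cl leq_addr.
  by move=> y _; rewrite subrr normr0 ltW.
have H1 j : \forall n \near \oo, forall x, `|x| <= r ->
    `|partial j (p n) x - partial j F x| <= e.
  have c1 : continuous (partial j F) := (F2.2 j).2.1.
  have [N HN] := bern_cvg r0 c1 e3.
  have [del del0 Hd] := near_fdiff c1 e3 (fun x => Ck_is_derive j x F2).
  near=> n => x xr.
  have n0 : (0 < n)%N by near: n; exists 1%N.
  have /andP[h0 hd] : 0 < h n < del by near: n; exact: cvg_le_inv_nat.
  rewrite dp// (_ : e = 3 * (e / 3)); last by field.
  apply: HN => //; first by near: n; exists N.
    move=> i; rewrite count_rem cl leq_subr; split=> //.
    by apply: leq_subKn_add; apply: (leq_trans (leq_b1 _)).
  by move=> y yr; rewrite mulrC; exact: Hd.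
have H2 i j : \forall n \near \oo, forall x, `|x| <= r ->
    `|partial i (partial j (p n)) x - partial i (partial j F) x| <= e.
  have c2 : continuous (partial i (partial j F)) by exact: ((F2.2 j).2.2 i).2.
  have [N HN] := bern_cvg r0 c2 e3.
  have e6 : 0 < e / 6 by rewrite divr_gt0.
  have [del del0 Hd] := near_fdiff2 i j F2 e6.
  have [b b0 Hb] := compact_normr_bounded (@rV_ball_compact R d r) c2.
  near=> n => x xr.
  have n0 : (0 < n)%N by near: n; exists 1%N.
  have /andP[h0 hd] : 0 < h n < del by near: n; exact: cvg_le_inv_nat.
  have /andP[_ nb] : 0 < b / n%:R < e / 6 by near: n; exact: cvg_le_inv_nat.
  rewrite ddp// (_ : e = 3 * (e / 3)); last by field.
  apply: HN => //; first by near: n; exists N.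
    move=> k; rewrite !count_rem cl -subnDA leq_subr; split=> //.
    by apply: leq_subKn_add; exact: leq_add (leq_b1 _) (leq_b1 _).
  move=> y yr; have := Hd _ h0 hd y yr; have := Hb y yr.
  have n0' : (0 : R) < n%:R by rewrite ltr0n.
  (* [c] is 1 if [i] differs from [j], and $1-1/n$ if they agree, as one jump in that direction is
     already used up. This defect costs at most $b/n<e/6$; the other $e/6$ is the error of the
     difference quotient. *)
  rewrite count_rem cl; set c := (_ : nat)%:R / _.
  set u := _ / _; set v := partial _ _ _ => vb uv.
  have /andP[c0 c1] : 1 - n%:R^-1 <= c <= 1.
    rewrite /c ler_pdivrMr// mul1r ler_nat leq_subr andbT.
    rewrite ler_pdivlMr// mulrBl mul1r mulVf ?gt_eqF// lerBlDr natr1 ler_nat.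
    by rewrite -addn1; apply: leq_subKn_add; exact: leq_b1.
  have -> : c * u - v = c * (u - v) - (1 - c) * v by ring.
  rewrite (le_trans (ler_normB _ _))// (_ : e / 3 = e / 6 + e / 6); last by
    field.
  have c0' : 0 <= c by rewrite divr_ge0// ltW.
  rewrite lerD// normrM.
    by rewrite ger0_norm// -[leRHS]mul1r ler_pM.
  rewrite ger0_norm ?subr_ge0//; apply: le_trans (ltW nb).
  by rewrite mulrC ler_pM// ?subr_ge0// lerBlDl -lerBlDr.
have H1' : \forall n \near \oo, forall j x, `|x| <= r ->
    `|partial j (p n) x - partial j F x| <= e.
  exact: filter_forall.
have H2' : \forall n \near \oo, forall i j x, `|x| <= r ->
    `|partial i (partial j (p n)) x - partial i (partial j F) x| <= e.
  by apply: filter_forall => i; exact: filter_forall.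
have [N _ HN] := filterI H0 (filterI H1' H2').
have [/= G0 [G1 G2]] := HN N (leqnn N).
exists (p N); first exact: smooth_bern.
move=> x xr; split; first exact: G0.
  by move=> j; exact: G1.
by move=> i j; exact: G2.
Unshelve. all: by end_near. Qed.

End C2_approximation.

(** * Comparison in L^1 semigroups *)

Lemma addr_norm_ge0 (R : realDomainType) (x : R) : 0 <= x + `|x|.
Proof. by rewrite -lerBlDl sub0r -normrN ler_norm. Qed.

Lemma cvge0_near_le (R : realType) (X : Type) (F : set_system X)
    (u : X -> \bar R) (b : R) : ProperFilter F ->
  u x @[x --> F] --> 0%E -> 0 < b -> \forall x \near F, (u x <= b%:E)%E.
Proof.
move=> FF /fine_cvgP[fin /cvgrPdist_lt cv] b0.
move: fin (cv b b0); apply: filterS2 => x finx.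
rewrite sub0r normrN => ub; rewrite -(fineK finx) lee_fin.
exact: le_trans (ler_norm _) (ltW ub).
Qed.

Section L1_errors.
Context {R : realType} {d : nat}.
Local Notation E := 'rV[R]_d.
Variable mu : {measure set E -> \bar R}.
Local Notation L1 f := (mu.-integrable [set: E] (EFin \o f)).
Implicit Types (f g e u v : E -> R).

Lemma LnormT1 f : LnormV mu setT 1 f = (\int[mu]_x `|f x|%:E)%E.
Proof. by rewrite /LnormV Lnorm1 patch_setT. Qed.

Lemma inLpT1 f : inLp mu setT 1 f <-> L1 f.
Proof.
rewrite /inLp LnormT1; split=> [[mf f1]|/integrableP[mf f1]].
  apply/integrableP; split=> //; exact/measurable_EFinP.
by split; [exact/measurable_EFinP|].
Qed.

Lemma L1_scale (c : R) f : L1 f -> L1 (fun x => c * f x).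
Proof. by move=> f1; exact (integrableZl measurableT c f1). Qed.

Lemma L1_add f g : L1 f -> L1 g -> L1 (fun x => f x + g x).
Proof. by move=> f1 g1; exact (integrableD measurableT f1 g1). Qed.

Lemma L1_lin (c : R) f g : L1 f -> L1 g -> L1 (fun x => c * f x + g x).
Proof. by move=> f1 g1; exact (L1_add (L1_scale c f1) g1). Qed.

Lemma L1_sub f g : L1 f -> L1 g -> L1 (fun x => f x - g x).
Proof. by move=> f1 g1; exact (integrableB measurableT f1 g1). Qed.

Lemma L1_measurable f : L1 f -> measurable_fun setT f.
Proof. by move/integrableP => [/measurable_EFinP]. Qed.

Lemma EFin_ge0 f : (forall x, 0 <= f x) ->
  forall x, [set: E] x -> (0 <= (EFin \o f) x)%E.
Proof. by move=> f0 x _; rewrite lee_fin. Qed.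

(** The semigroup is controlled in $L^1$ norm, so an error is kept as a function together with a
    bound on its integral. *)
Definition L1_small e (b : R) := [/\ L1 e, forall x, 0 <= e x &
  (\int[mu]_x (e x)%:E <= b%:E)%E].

Lemma L1_small_add e e' (b b' : R) : L1_small e b -> L1_small e' b' ->
  L1_small (fun x => e x + e' x) (b + b').
Proof.
move=> [e1 e0 eb] [e'1 e'0 e'b]; split; first exact: L1_add.
  by move=> x; rewrite addr_ge0.
have -> : (\int[mu]_x (e x + e' x)%:E =
    \int[mu]_x (e x)%:E + \int[mu]_x (e' x)%:E)%E.
  have /integrableP[me _] := e1; have /integrableP[me' _] := e'1.
  exact (ge0_integralD mu measurableT (EFin_ge0 e0) me (EFin_ge0 e'0) me').
by rewrite EFinD leeD.
Qed.

Lemma L1_small_scale (k : R) e (b : R) : 0 <= k -> L1_small e b ->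
  L1_small (fun x => k * e x) (k * b).
Proof.
move=> k0 [e1 e0 eb]; split; first exact: L1_scale.
  by move=> x; rewrite mulr_ge0.
have -> : (\int[mu]_x (k * e x)%:E = k%:E * \int[mu]_x (e x)%:E)%E.
  have /integrableP[me _] := e1.
  exact (ge0_integralZl_EFin mu measurableT (EFin_ge0 e0) me k0).
by rewrite EFinM lee_wpmul2l// lee_fin.
Qed.

Lemma L1_small_le e (b b' : R) : b <= b' -> L1_small e b -> L1_small e b'.
Proof.
by move=> bb' [e1 e0 eb]; split=> //; rewrite (le_trans eb)// lee_fin.
Qed.

Lemma L1_small_norm f (b : R) : L1 f -> (\int[mu]_x `|f x|%:E <= b%:E)%E ->
  L1_small (fun x => `|f x|) b.
Proof.
move=> f1 fb; split=> //; exact: integrable_norm.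
Qed.

Lemma L1_small_bound_ge0 e (b : R) : L1_small e b -> 0 <= b.
Proof.
move=> [_ e0 eb]; rewrite -lee_fin; apply: le_trans eb.
by apply: integral_ge0 => x _; rewrite lee_fin.
Qed.

(** The positive part of [f - g] has integral at most [b] for every [b > 0], hence vanishes almost
    everywhere. Only measurability of [f] and [g] is required, since they contain the constant
    [c]. *)
Lemma ae_le_small f g : measurable_fun setT f -> measurable_fun setT g ->
  (forall b : R, 0 < b -> exists2 e, L1_small e b &
    {ae mu, forall x, f x <= g x + e x}) ->
  {ae mu, forall x, f x <= g x}.
Proof.
move=> mf mg H.
pose u x := Num.max (f x - g x) 0.
have measu : measurable_fun setT u by apply: measurable_maxr => //; exact:
  measurable_funB.
have u0 x : 0 <= u x by rewrite /u le_max lexx orbT.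
have Iu : (\int[mu]_x `|(u x)%:E| = 0)%E.
  apply/eqP; rewrite eq_le integral_ge0 ?andbT; last by move=> x _.
  apply/lee_addgt0Pr => b b0; rewrite add0e.
  have [e [e1 e0 eb] fge] := H b b0.
  apply: le_trans eb; apply: ae_ge0_le_integral => //.
  - by apply: measurableT_comp => //; exact/measurable_EFinP.
  - by move=> x _; rewrite lee_fin.
  - by have /integrableP[] := e1.
  - apply: filterS fge => x fgex _; rewrite abse_EFin ger0_norm// lee_fin.
    by rewrite /u ge_max e0 andbT lerBlDl.
have /ae_eq_integral_abs := Iu => /(_ measurableT).
move=> /(_ (proj2 (measurable_EFinP _ _) measu)).
apply: filterS => x /(_ Logic.I) [] ux.
by rewrite -subr_le0 -ux /u le_max lexx.
Qed.

End L1_errors.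

Section L1_semigroup_comparison.
Context {R : realType} {d : nat}.
Local Notation E := 'rV[R]_d.
Variable mu : {measure set E -> \bar R}.
Variable T : R -> (E -> R) -> E -> R.
Hypothesis hT : sub_markovian_C0_semigroup mu setT T.
Local Notation L1 f := (mu.-integrable [set: E] (EFin \o f)).
Implicit Types (f g e u v w : E -> R) (t : R).

Lemma semigroup_in_L1 t f : 0 < t -> L1 f -> L1 (T t f).
Proof. by move=> t0 /inLpT1 f1; apply/inLpT1; exact: (semigroup_L1 hT). Qed.

Lemma semigroup_lin t (c : R) f g : 0 < t -> L1 f -> L1 g ->
  {ae mu, forall x, T t (fun y => c * f y + g y) x = c * T t f x + T t g x}.
Proof.
move=> t0 /inLpT1 f1 /inLpT1 g1.
by have := semigroup_linear hT c t0 f1 g1; apply: filterS => x /(_ Logic.I).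
Qed.

Lemma semigroup_comp t s f : 0 < t -> 0 < s -> L1 f ->
  {ae mu, forall x, T (t + s) f x = T t (T s f) x}.
Proof.
move=> t0 s0 /inLpT1 f1.
by have := semigroup_add hT t0 s0 f1; apply: filterS => x /(_ Logic.I).
Qed.

Lemma semigroup_small t f (b : R) : 0 < t -> L1 f ->
  (\int[mu]_x `|f x|%:E <= b%:E)%E -> L1_small mu (fun x => `|T t f x|) b.
Proof.
move=> t0 f1 fb; apply: L1_small_norm; first exact: semigroup_in_L1.
apply: le_trans fb; rewrite -!LnormT1; apply: (semigroup_contraction hT) => //.
exact/inLpT1.
Qed.

Lemma semigroup_range01 t f : 0 < t -> L1 f -> (forall x, 0 <= f x <= 1) ->
  {ae mu, forall x, 0 <= T t f x <= 1}.
Proof.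
move=> t0 /inLpT1 f1 f01.
have : {ae mu, forall x, [set: E] x -> 0 <= f x <= 1} by apply: nearW.
move=> /(semigroup_sub_markovian hT t0 f1).
by apply: filterS => x /(_ Logic.I).
Qed.

Lemma truncation_cvg f (b : R) : L1 f -> {ae mu, forall x, 0 <= f x} -> 0 < b ->
  exists n : nat, [/\ (0 < n)%N,
    L1 (fun x => Num.max 0 (Num.min (f x) n%:R)) &
    (\int[mu]_x `|f x - Num.max 0 (Num.min (f x) n%:R)|%:E <= b%:E)%E].
Proof.
move=> f1 f0 b0.
pose fn n x := Num.max 0 (Num.min (f x) n%:R).
have mf := L1_measurable f1.
have mfn n : measurable_fun setT (fn n).
  by apply: measurable_maxr => //; exact: measurable_minr.
have fn_le n x : `|fn n x| <= `|f x|.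
  rewrite /fn ger0_norm ?le_max ?lexx// ge_max normr_ge0/=.
  by rewrite ge_min ler_norm.
have [] := @dominated_convergence _ E R mu setT measurableT
  (fun n => EFin \o fn n) (EFin \o f) (EFin \o (normr \o f)).
- by move=> n; exact/measurable_EFinP.
- exact/measurable_EFinP.
- apply: filterS f0 => x fx0 _; apply: cvg_near_cst.
  exists (Num.bound (f x)) => // n /= nf.
  rewrite /fn min_l ?max_r//.
  rewrite (le_trans (ltW (archi_boundP fx0)))// ler_nat//.
- exact: integrable_norm.
- by apply: nearW => x n _; rewrite /= lee_fin fn_le.
move=> _ cv _.
have /fine_cvgP[fin /cvgrPdist_lt/(_ b b0) cvb] := cv.
have [N _ HN] := filterI (filterI fin cvb) (nbhs_infty_gt 0).
have [[/= finN cvN] N0] := HN N (leqnn N).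
exists N; split=> //.
  apply: (le_integrable measurableT _ _ (integrable_norm f1)).
    exact ((measurable_EFinP _ _).2 (mfn N)).
  by move=> x _; rewrite /= lee_fin normr_id; exact: fn_le.
have -> : (\int[mu]_x `|f x - fn N x|%:E =
    \int[mu]_x `|(fn N x)%:E - (f x)%:E|)%E.
  by apply: eq_integral => x _; rewrite -EFinB abse_EFin distrC.
move: cvN; rewrite sub0r normrN => cvN.
rewrite -(fineK finN) lee_fin; apply: le_trans (ltW cvN); exact: ler_norm.
Qed.

(** The sub-Markov property speaks of functions with values in $[0,1]$ only. The truncation of [f]
    at [n], divided by [n], is such a function, and the remainder stays small in $L^1$ by
    contraction. *)
Lemma semigroup_pos t f : 0 < t -> L1 f -> {ae mu, forall x, 0 <= f x} ->
  {ae mu, forall x, 0 <= T t f x}.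
Proof.
move=> t0 f1 f0; apply: (@ae_le_small _ _ mu) => [||b b0].
- exact: measurable_cst.
- exact: (L1_measurable (semigroup_in_L1 t0 f1)).
have [n [n0 fn1 fnb]] := truncation_cvg f1 f0 b0.
set fn := fun x => _ in fn1.
have n0' : (0 : R) < n%:R by rewrite ltr0n.
pose gn x := n%:R^-1 * fn x.
have gn1 : L1 gn by exact: L1_scale.
have gn01 x : 0 <= gn x <= 1.
  rewrite /gn /fn mulr_ge0 ?invr_ge0 ?le_max ?lexx ?(ltW n0')//=.
  by rewrite ler_pdivrMl// mulr1 ge_max (ltW n0')/= ge_min lexx orbT.
pose hn x := f x - fn x.
have hn1 : L1 hn by exact: L1_sub.
exists (fun x => `|T t hn x|); first exact: semigroup_small.
have fE : f = (fun x => n%:R * gn x + hn x).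
  by apply/funext => x; rewrite /gn /hn mulVKf ?gt_eqF// addrC subrK.
have := semigroup_range01 t0 gn1 gn01; have := semigroup_lin n%:R t0 gn1 hn1.
apply: filterS2 => x Tx /andP[g0 _].
rewrite (congr1 (fun g => T t g x) fE) Tx.
rewrite -addrA addr_ge0 ?addr_norm_ge0//.
by apply: mulr_ge0; first exact: ltW.
Qed.

(* One explicit Euler step [T_h u = u + h v + h r] of size [h = t / n] loses
   a factor [1 + h M]; iterating it [n] times gives [expR (M * t)]. *)
Lemma euler_comparison u v kappa del (c M D t : R) :
  generator mu setT T u v -> L1 kappa -> (forall x, 0 <= kappa x <= 1) ->
  L1_small mu del D -> 0 <= c -> 0 <= M -> 0 < t ->
  {ae mu, forall x, M * u x - M * c * kappa x - del x <= v x} ->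
  forall b : R, 0 < b ->
  exists2 e, L1_small mu e (t * expR (M * t) * D + b) &
  {ae mu, forall x, c - T t u x <= expR (M * t) * Num.max (c - u x) 0 + e x}.
Proof.
move=> [/inLpT1 u1 /inLpT1 v1 gen] k1 k01 delD c0 M0 t0 vu b b0.
(* Bound on the one-step remainder; accumulated over all steps it contributes
   [t * expR (M * t) * B], which is [b]. *)
pose B := b / (t * expR (M * t)).
have B0 : 0 < B by rewrite divr_gt0// mulr_gt0// expR_gt0.
have [n n0 rn] : exists2 n, (0 < n)%N & (\int[mu]_x `|(t / n%:R)^-1 *
    (T (t / n%:R) u x - u x) - v x|%:E <= B%:E)%E.
  have Hd : \forall s \near (0 : R), 0 < s ->
      (LnormV mu setT 1 (fun x => s^-1 * (T s u x - u x) - v x)%R <= B%:E)%E.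
    by have := cvge0_near_le (at_right_proper_filter 0) gen B0; rewrite
      near_withinE.
  have /nbhs_ballP[r /= r0 Hr] := Hd.
  have [N _ HN] := filterI (cvg_le_inv_nat t0 r0) (nbhs_infty_gt 0).
  have [/= /andP[h0 hr] N0] := HN N (leqnn N).
  exists N => //; rewrite -LnormT1; apply: Hr => //.
  by rewrite /ball/= sub0r normrN gtr0_norm.
have n0' : (0 : R) < n%:R by rewrite ltr0n.
set h := t / n%:R in rn.
have h0 : 0 < h by rewrite divr_gt0.
pose r x := h^-1 * (T h u x - u x) - v x.
have Tu1 : L1 (T h u) by exact: semigroup_in_L1.
have r1 : L1 r by apply: L1_sub => //; apply: L1_scale; exact: L1_sub.
pose eta x := del x + `|r x|.
have etaD : L1_small mu eta (D + B) by apply: L1_small_add => //; exact: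
  L1_small_norm.
have [eta1 eta0 etaB] := etaD.
(* The slack of one Euler step, nonnegative because of the assumption on [v] and of $r+|r|\ge0$.
   When $T_{kh}$ is applied, [W] is dropped by positivity and [kappa] is bounded by 1; only [eta]
   remains as an error. *)
pose W x := T h u x - (1 + h * M) * u x - - (h * M * c) * kappa x - - h * eta x.
have W1 : L1 W.
  by apply: L1_sub; [apply: L1_sub; [apply: L1_sub => //|]|]; exact: L1_scale.
have W0 : {ae mu, forall x, 0 <= W x}.
  apply: filterS vu => x vux.
  have -> : W x = h * (v x - (M * u x - M * c * kappa x - del x)) +
      h * (r x + `|r x|).
    by rewrite /W /eta /r; field; rewrite gt_eqF.
  by rewrite addr_ge0// mulr_ge0 ?(ltW h0) ?subr_ge0 ?addr_norm_ge0.
have step k : (0 < k)%N ->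
  {ae mu, forall x, (1 + h * M) * T (k%:R * h) u x - h * M * c -
    `|T (k%:R * h) (fun y => - h * eta y) x| <= T (k.+1%:R * h) u x}.
  move=> k0; have kh0 : 0 < k%:R * h by rewrite mulr_gt0// ltr0n.
  have heta1 : L1 (fun y => - h * eta y) by exact: L1_scale.
  have k2 : L1 (fun y => - (h * M * c) * kappa y + - h * eta y) by exact:
    L1_lin.
  have k3 : L1 (fun y => (1 + h * M) * u y +
     (- (h * M * c) * kappa y + - h * eta y)) by exact: L1_lin.
  have A1 := semigroup_lin 1 kh0 W1 k3.
  have A2 := semigroup_lin (1 + h * M) kh0 u1 k2.
  have A3 := semigroup_lin (- (h * M * c)) kh0 k1 heta1.
  have A4 := semigroup_pos kh0 W1 W0.
  have A5 := semigroup_range01 kh0 k1 k01.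
  have A6 := semigroup_comp kh0 h0 u1.
  have TuE : T h u = (fun y => 1 * W y + ((1 + h * M) * u y +
     (- (h * M * c) * kappa y + - h * eta y))).
    by apply/funext => x; rewrite /W; ring.
  rewrite -[k.+1%:R]natr1 mulrDl mul1r.
  have A123 : {ae mu, forall x, T (k%:R * h) (T h u) x = 1 * T (k%:R * h) W x +
      ((1 + h * M) * T (k%:R * h) u x + (- (h * M * c) * T (k%:R * h) kappa x +
      T (k%:R * h) (fun y => - h * eta y) x))}.
    move: A1 A2 A3; apply: filterS3 => x.
    by rewrite (congr1 (fun g => T (k%:R * h) g x) TuE) => -> -> ->.
  have A45 : {ae mu, forall x, 0 <= T (k%:R * h) W x /\ T (k%:R * h) kappa x <=
    1}.
    by move: A4 A5; apply: filterS2 => x ? /andP[].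
  move: A123 A45 A6; apply: filterS3 => x a1 [a4 a52] a6.
  rewrite a6 a1.
  have : - `|T (k%:R * h) (fun y => - h * eta y) x| <=
      T (k%:R * h) (fun y => - h * eta y) x by rewrite lerNl -normrN ler_norm.
  have : h * M * c * T (k%:R * h) kappa x <= h * M * c.
    by rewrite -[leRHS]mulr1 ler_wpM2l// !mulr_ge0// ltW.
  lra.
have etaT k : (0 < k)%N ->
    L1_small mu (fun x => `|T (k%:R * h) (fun y => - h * eta y) x|) (h * (D +
      B)).
  move=> k0; apply: semigroup_small; first by rewrite mulr_gt0// ltr0n.
    exact: L1_scale.
  have [_ _] := L1_small_scale (ltW h0) etaD; apply: le_trans.
  rewrite le_eqVlt; apply/orP; left; apply/eqP; apply: eq_integral => x _.
  by rewrite mulNr normrN ger0_norm// mulr_ge0// ltW.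
have hM1 : 1 <= 1 + h * M by rewrite lerDl mulr_ge0// ltW.
have DB0 : 0 <= D + B := L1_small_bound_ge0 etaD.
(* Iterates $c-T_{(k+1)h}u\le(1+hM)(c-T_{kh}u)+\text{error}$, a rearrangement of [step]. The
   induction starts at one step, as the semigroup is given for positive times only. *)
have iter k : (0 < k)%N -> exists2 e,
  L1_small mu e (k%:R * h * (1 + h * M) ^+ k * (D + B)) &
  {ae mu, forall x, c - T (k%:R * h) u x <= (1 + h * M) ^+ k * (c - u x) + e x}.
  elim: k => // -[_ _|k ih _].
    exists (fun x => h * eta x).
      apply: L1_small_le (L1_small_scale (ltW h0) etaD).
      rewrite mul1r expr1 -mulrA ler_wpM2l// ?(ltW h0)//.
      by rewrite -[leLHS]mul1r ler_wpM2r.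
    move: W0; apply: filterS => x; rewrite mul1r expr1 /W.
    have : h * M * c * kappa x <= h * M * c.
      have /andP[_ ?] := k01 x.
      by rewrite -[leRHS]mulr1 ler_wpM2l// !mulr_ge0// ltW.
    lra.
  have [e esm He] := ih isT.
  exists (fun x => (1 + h * M) * e x + `|T (k.+1%:R * h) (fun y => - h * eta y)
    x|).
    apply: L1_small_le (L1_small_add (L1_small_scale _ esm) (etaT k.+1 isT));
      last first.
      exact: le_trans hM1.
    have -> : k.+2%:R * h * (1 + h * M) ^+ k.+2 * (D + B) =
      (1 + h * M) * (k.+1%:R * h * (1 + h * M) ^+ k.+1 * (D + B)) +
      (1 + h * M) ^+ k.+2 * (h * (D + B)).
      by rewrite -[k.+2%:R]natr1 !exprS; ring.
    rewrite lerD2l -[leLHS]mul1r; apply: ler_wpM2r; last exact: exprn_ege1.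
    by apply: mulr_ge0 => //; exact: ltW.
  move: He (step k.+1 isT); apply: filterS2 => x.
  move=> /(ler_wpM2l (le_trans ler01 hM1)) H1 H2.
  rewrite exprS -mulrA; lra.
have [e eB He] := iter n n0.
have nh : n%:R * h = t by rewrite /h mulrC divfK// gt_eqF.
have eMt : (1 + h * M) ^+ n <= expR (M * t).
  rewrite -nh mulrCA expRM_natl (mulrC M).
  apply: lerXn2r; rewrite ?nnegrE ?expR_ge0//; last exact: expR_ge1Dx.
  exact: le_trans hM1.
exists e.
  apply: L1_small_le eB; rewrite nh mulrDr [leRHS](_ : _ =
    t * expR (M * t) * D + t * expR (M * t) * B); last first.
    by rewrite /B [t * _ * (b / _)]mulrC divfK// mulf_neq0 ?gt_eqF ?expR_gt0.
  have D0 : 0 <= D := L1_small_bound_ge0 delD.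
  by apply: lerD; apply: ler_wpM2r => //; rewrite ?(ltW B0)// ler_wpM2l// ltW.
move: He; rewrite nh; apply: filterS => x /le_trans; apply.
(* Replacing the power by the larger exponential needs a nonnegative factor; [u] may exceed [c],
   hence the maximum. *)
rewrite lerD2r; apply: (@le_trans _ _ ((1 + h * M) ^+ n * Num.max (c - u x) 0)).
  by rewrite ler_wpM2l ?exprn_ge0 ?(le_trans ler01 hM1)// le_max lexx.
by rewrite ler_wpM2r// le_max lexx orbT.
Qed.

(** Allows a [w] outside the known domain of the generator: [w] may be exchanged for an approximant
    [u] at the cost of $|T_t(w-u)|+e^{Mt}|w-u|$, which is small in $L^1$ by contraction. *)
Lemma lyapunov_comparison w kappa (c M t : R) :
  L1 w -> (forall x, w x <= c) -> L1 kappa -> (forall x, 0 <= kappa x <= 1) ->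
  0 <= c -> 0 <= M -> 0 < t ->
  (forall e : R, 0 < e -> exists u v del, [/\ generator mu setT T u v,
    L1_small mu del e, (\int[mu]_x `|w x - u x|%:E <= e%:E)%E &
    {ae mu, forall x, M * u x - M * c * kappa x - del x <= v x}]) ->
  {ae mu, forall x, c - T t w x <= expR (M * t) * (c - w x)}.
Proof.
move=> w1 wc k1 k01 c0 M0 t0 H.
have mw := L1_measurable w1.
apply: (@ae_le_small _ _ mu) => [||b b0].
- apply: measurable_funB => //; exact: (L1_measurable (semigroup_in_L1 t0 w1)).
- by apply: measurable_funM => //; exact: measurable_funB.
(* The three weights belong to [del], to $T_t(w-u)$ and to $e^{Mt}|w-u|$. *)
pose K := t * expR (M * t) + 1 + expR (M * t).
have eM0 : 0 < expR (M * t) by exact: expR_gt0.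
have K0 : 0 < K by rewrite !addr_gt0// mulr_gt0.
have b2 : 0 < b / 2 by rewrite divr_gt0.
have [|u [v [del [guv dele wue vge]]]] := H (b / 2 / K); first by rewrite
  divr_gt0.
set ep := b / 2 / K in dele wue.
have [e esm He] := euler_comparison guv k1 k01 dele c0 M0 t0 vge b2.
have [/inLpT1 u1 _ _] := guv.
have wu1 : L1 (fun x => w x - u x) by exact: L1_sub.
exists (fun x => e x + (`|T t (fun x => w x - u x) x| + expR (M * t) * `|w x -
  u x|)).
  apply: L1_small_le (L1_small_add esm (L1_small_add (semigroup_small t0 wu1
    wue)
    (L1_small_scale (ltW eM0) (L1_small_norm wu1 wue)))).
  rewrite (_ : _ + (_ + _) = K * ep + b / 2); last by rewrite /K; ring.
  by rewrite /ep [K * _]mulrC divfK ?gt_eqF// -splitr.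
have A := semigroup_lin 1 t0 wu1 u1.
have wE : w = (fun x => 1 * (w x - u x) + u x).
  by apply/funext => x; rewrite mul1r subrK.
move: A He; apply: filterS2 => x.
rewrite -(congr1 (fun g => T t g x) wE) mul1r => -> He.
have : - `|T t (fun x => w x - u x) x| <= T t (fun x => w x - u x) x.
  by rewrite lerNl -normrN ler_norm.
have h1 : Num.max (c - u x) 0 <= (c - w x) + `|w x - u x|.
  rewrite ge_max addr_ge0 ?subr_ge0// andbT.
  by have := ler_norm (w x - u x); lra.
have := ler_wpM2l (ltW eM0) h1.
lra.
Qed.

End L1_semigroup_comparison.

(** * The weighted measure *)

Section borel_rV.
Context {R : realType} {d : nat}.
Local Notation E := 'rV[R]_d.

Lemma open_measurable_rV (U : set E) : open U -> measurable U.
Proof. by move=> oU; exact: sub_sigma_algebra. Qed.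

Lemma closed_measurable_rV (U : set E) : closed U -> measurable U.
Proof.
by move=> cU; rewrite -[U]setCK; apply: measurableC; apply: open_measurable_rV;
  exact: closed_openC.
Qed.

Lemma continuous_measurable_rV (f : E -> R) : continuous f -> measurable_fun
  setT f.
Proof.
move=> cf; apply: (measurability _ (RGenOInfty.measurableE R)) => //.
move=> _ [_ [a ->] <-]; apply: measurableI => //; apply: open_measurable_rV.
apply: open_comp; first by move=> x _; exact: cf.
exact: interval_open.
Qed.

Definition cube (r : R) : set E := [set x | `|x| <= r].

Lemma measurable_cube r : measurable (cube r).
Proof.
apply: closed_measurable_rV; apply: compact_closed; first exact: norm_hausdorff.
exact: rV_ball_compact.
Qed.

Lemma measurable_box (a b : E) :
  measurable [set x : E | forall i, a 0 i < x 0 i <= b 0 i].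
Proof.
have -> : [set x : E | forall i, a 0 i < x 0 i <= b 0 i] =
    \bigcap_(i : 'I_d) ([set x : E | a 0 i < x 0 i] `&`
                        ~` [set x : E | b 0 i < x 0 i]).
  apply/seteqP; split=> x /= H i.
    by move=> _; have /andP[h1 h2] := H i; split=> //; apply/negP; rewrite
      -leNgt.
  by have [/= -> /negP] := H i Logic.I; rewrite -leNgt.
have mgt (c : R) i : measurable [set x : E | c < x 0 i].
  apply: open_measurable_rV.
  apply: (@open_comp _ _ (fun x : E => x 0 i) [set y | c < y]).
    by move=> x _; exact: coord_continuous.
  exact: open_gt.
by apply: fin_bigcap_measurable => // i _; apply: measurableI => //; exact:
  measurableC.
Qed.

Lemma lebesgue_cube_lty r : (lebesgue_rV d (cube r) < +oo)%E.
Proof.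
(* The boxes of [lebesgue_rV_box] are open on the left, so the lower corner is lowered by 1. *)
pose a : E := const_mx (- (`|r| + 1)); pose b : E := const_mx `|r|.
have ab i : a 0 i <= b 0 i by rewrite !mxE; have := normr_ge0 r; lra.
pose S := [set x : E | forall i, a 0 i < x 0 i <= b 0 i].
have mS : measurable S by exact: measurable_box.
have : (lebesgue_rV d (cube r) <= lebesgue_rV d S)%E.
  apply: le_measure; rewrite ?inE//; first exact: measurable_cube.
  move=> x /= xr i; have := le_trans (rV_coord_le x i) xr.
  rewrite !mxE ler_norml => /andP[x1 x2]; have := ler_norm r.
  move=> rr; apply/andP; split; lra.
by move/le_lt_trans; apply; rewrite lebesgue_rV_box// ltry.
Qed.

End borel_rV.

Section weighted_measure.
Context {R : realType} {d : nat}.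
Local Notation E := 'rV[R]_d.
Local Notation leb := (@lebesgue_rV R d).
Variables (rho : E -> R) (mu : {measure set E -> \bar R}).
Hypothesis crho : continuous rho.
Hypothesis rho_pos : forall x, 0 < rho x.
Hypothesis mu_rho : forall B : set E, measurable B ->
    mu B = (\int[leb]_(x in B) (rho x)%:E)%E.
Local Notation L1 f := (mu.-integrable [set: E] (EFin \o f)).

Lemma measurable_rho (S : set E) : measurable_fun S (EFin \o rho).
Proof.
by apply/measurable_EFinP; apply: measurable_funTS; exact:
  continuous_measurable_rV.
Qed.

Lemma mu_le_lebesgue r : exists b : {nonneg R}, forall S : set E, measurable S
  ->
  S `<=` cube r -> (mu S <= b%:num%:E * leb S)%E.
Proof.
have [b b0 Hb] := compact_normr_bounded (@rV_ball_compact R d r) crho.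
exists (NngNum (ltW b0)) => S mS SB /=; rewrite mu_rho//.
rewrite -(integral_cst leb mS b%:E); apply: ge0_le_integral => //.
- by move=> x _; rewrite lee_fin ltW.
- exact: measurable_rho.
- by move=> x Sx; rewrite lee_fin (le_trans (ler_norm _))// Hb//; exact: SB.
Qed.

Lemma mu_cube_lty r : (mu (cube r) < +oo)%E.
Proof.
have [b Hb] := mu_le_lebesgue r.
apply: le_lt_trans (Hb _ (measurable_cube r) (@subset_refl _ _)) _.
by apply: lte_mul_pinfty => //; exact: lebesgue_cube_lty.
Qed.

Lemma ae_lebesgue_mu (P : E -> Prop) :
  {ae leb, forall x, P x} -> {ae mu, forall x, P x}.
Proof.
move=> [N [mN N0 PN]]; exists N; split=> //.
rewrite mu_rho//; apply: null_set_integral => //.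
exact: measurable_rho.
Qed.

(** [mu] charges every small box: near a point where the inequality failed, [rho] is at least half
    its value there, and the box has positive volume. *)
Lemma ae_le_continuous (f g : E -> R) : continuous f -> continuous g ->
  {ae mu, forall x, f x <= g x} -> forall x, f x <= g x.
Proof.
move=> cf cg [N [mN N0 fgN]] x0; rewrite leNgt; apply/negP => gf.
pose m := rho x0 / 2.
have m0 : 0 < m by rewrite divr_gt0.
have near1 : \forall x \near x0, 0 < f x - g x.
  have cfg : {for x0, continuous (f \- g)}.
    change (continuous_at x0 (f - g)); exact (continuousB (cf x0) (cg x0)).
  have : \forall y \near (f \- g) x0, 0 < y by apply: lt_nbhsr; rewrite /=
    subr_gt0.
  exact: cfg.
have near2 : \forall x \near x0, m < rho x.
  have : \forall y \near rho x0, m < y.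
    by apply: lt_nbhsr; rewrite /m ltr_pdivrMr// ltr_pMr// ltr1n.
  exact: crho.
have /nbhs_ballP[e1 /= e10 He1] := near1.
have /nbhs_ballP[e2 /= e20 He2] := near2.
pose e := Num.min e1 e2.
have e0 : 0 < e by rewrite lt_min e10.
pose a : E := x0 - const_mx (e / 2); pose b : E := x0 + const_mx (e / 2).
have ab i : a 0 i <= b 0 i by rewrite !mxE; lra.
pose S := [set x : E | forall i, a 0 i < x 0 i <= b 0 i].
have mS : measurable S by exact: measurable_box.
have Se x : S x -> `|x0 - x| < e.
  move=> Sx; apply: (@le_lt_trans _ _ (e / 2)); last by rewrite ltr_pdivrMr//
    ltr_pMr// ltr1n.
  rewrite rV_norm_le ?divr_ge0 ?(ltW e0)//; apply/forallP => i.
  have := Sx i; rewrite !mxE => /andP[? ?]; rewrite ler_norml; apply/andP;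
    split; lra.
have : (m%:E * leb S <= mu S)%E.
  rewrite mu_rho// -(integral_cst leb mS m%:E); apply: ge0_le_integral => //.
  - by move=> x _; rewrite lee_fin ltW.
  - exact: measurable_rho.
  - move=> x Sx; rewrite lee_fin ltW//; apply: He2; rewrite /= -ball_normE/=.
    by rewrite (lt_le_trans (Se _ Sx))// ge_min lexx orbT.
have -> : mu S = 0%E.
  apply/eqP; rewrite eq_le measure_ge0 andbT -N0; apply: le_measure; rewrite
    ?inE//.
  move=> x Sx; apply: fgN => /=; apply/negP; rewrite -ltNge -subr_gt0.
  apply: He1; rewrite /= -ball_normE/=.
  by rewrite (lt_le_trans (Se _ Sx))// ge_min lexx.
rewrite lebesgue_rV_box// -EFinM lee_fin leNgt mulr_gt0//.
apply: prodr_gt0 => i _; rewrite !mxE; lra.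
Qed.

Lemma L1_bounded (f : E -> R) (r K : R) : measurable_fun setT f ->
  (forall x, `|x| <= r -> `|f x| <= K) -> (forall x, r < `|x| -> f x = 0) ->
  L1 f /\ (\int[mu]_x `|f x|%:E <= K%:E * mu (cube r))%E.
Proof.
move=> mf fK f0.
have I : (\int[mu]_x `|f x|%:E <= K%:E * mu (cube r))%E.
  have -> : (\int[mu]_x `|f x|%:E = \int[mu]_(x in cube r) `|f x|%:E)%E.
    rewrite [RHS]integral_mkcond; apply: eq_integral => x _.
    rewrite patchE; case: ifPn => //; rewrite notin_setE /cube/= => /negP.
    by rewrite -ltNge => /f0 ->; rewrite normr0.
  rewrite -(integral_cst mu (measurable_cube r) K%:E).
  apply: ge0_le_integral => //; first exact: measurable_cube.
  apply/measurable_EFinP; apply: measurable_funTS.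
  exact: measurableT_comp.
split=> //; apply/integrableP; split; first exact/measurable_EFinP.
apply: le_lt_trans I _; have [K0|K0] := leP 0 K.
  by apply: lte_mul_pinfty => //; exact: mu_cube_lty.
apply: (@le_lt_trans _ _ 0%E) => //; apply: mule_le0_ge0 => //.
by rewrite lee_fin ltW.
Qed.

(** On the cube [mu] is at most a multiple of Lebesgue measure, and $|f|\le1+|f|^q$. *)
Lemma L1_cube_Lploc (f : E -> R) (r q : R) : 1 <= q -> Lploc q setT f ->
  L1 (fun x => \1_(cube r) x * `|f x|).
Proof.
move=> q1 [mf fq]; have mB := @measurable_cube R d r.
have [b Hb] := mu_le_lebesgue r.
have mnf : measurable_fun setT (fun x => `|f x|%:E).
  by apply/measurable_EFinP; exact: measurableT_comp.
(* Integrals are compared through an inequality of measures valid on all sets, so [mu] restricted to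
   the complement of the cube is added; it contributes nothing over the cube. *)
have mu2 S : measurable S -> (mu S <= measure_add (mscale b leb) (mrestr mu
  (measurableC mB)) S)%E.
  move=> mS; rewrite measure_addE (measureDI mu mS mB) addeC.
  apply: leeD; last by rewrite /mrestr setDE.
  apply: (le_trans (Hb _ (measurableI _ _ mS mB) _)); first exact: subIsetr.
  rewrite /mscale/=; apply: lee_wpmul2l; first by rewrite lee_fin.
  apply: le_measure; first exact: measurable_row_of_tuple.
  - by rewrite inE; exact: measurableI.
  - by rewrite inE.
  - exact: subIsetl.
apply/integrableP; split.
  by apply/measurable_EFinP; apply: measurable_funM; [exact:
    measurable_indic|exact: measurableT_comp].
have -> : (\int[mu]_x `|(EFin \o (fun x => \1_(cube r) x * `|f x|)%R) x| =
   \int[mu]_(x in cube r) `|f x|%:E)%E.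
  rewrite [RHS]integral_mkcond; apply: eq_integral => x _.
  rewrite patchE /= indicE; case: ifPn => _; first by rewrite mul1r normr_id.
  by rewrite mul0r normr0.
apply: (le_lt_trans (ge0_le_measure_integral mu2 mB _ _)) => //.
rewrite ge0_integral_measure_add//; last exact: measurable_funTS.
rewrite ge0_integral_mscale//; last exact: measurable_funTS.
rewrite (_ : integral (mrestr mu (measurableC mB)) _ _ = 0%E); last first.
  under eq_integral => x _ do rewrite -abse_EFin.
  apply: integral_abs_eq0; first exact: mB.
    by apply: measurable_funTS; exact/measurable_EFinP.
  by change (mu (cube r `&` ~` cube r) = 0%E); rewrite setICr measure0.
rewrite adde0; apply: lte_mul_pinfty => //.
have mq : measurable_fun setT (fun x => (`|f x| `^ q)%:E).
  apply/measurable_EFinP; apply: (measurableT_comp (measurable_powR q)).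
  exact: measurableT_comp.
have := fq _ (@rV_ball_compact R d r) (@subsetT _ _) => fqB.
apply: (@le_lt_trans _ _ (\int[leb]_(x in cube r) (1 + (`|f x| `^ q)%:E))%E).
  apply: ge0_le_integral => //.
  - exact: measurable_funTS.
  - apply: measurable_funTS; apply: emeasurable_funD => //.
  - move=> x _; have [f1|f1] := leP `|f x| 1.
      rewrite -EFinD lee_fin (le_trans f1)// lerDl powR_ge0//.
    rewrite -EFinD lee_fin -[leLHS]powRr1//.
    by apply: (le_trans (ler_powR (ltW f1) q1)); rewrite lerDr.
rewrite ge0_integralD//.
- rewrite integral_cst// mul1e lte_add_pinfty//; exact: lebesgue_cube_lty.
- exact: measurable_funTS.
Qed.

Lemma L1_sum (I : Type) (s : seq I) (F : I -> E -> R) :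
  (forall i, L1 (F i)) -> L1 (fun x => \sum_(i <- s) F i x).
Proof.
move=> HF; elim: s => [|i s ih].
  under eq_fun do rewrite big_nil; exact: integrable0.
by under eq_fun do rewrite big_cons; exact: L1_add.
Qed.

End weighted_measure.

(** * The truncated Lyapunov function *)

Section flat_inequalities.
Context {R : realType}.
Implicit Types (P : {poly R}) (y a b : R).

Lemma expR_ge1Dx2 (z : R) : 0 <= z -> 1 + z + z ^+ 2 / 2 <= expR z.
Proof.
move=> z0; have -> : 1 + z + z ^+ 2 / 2 = series (exp_coeff z) 3.
  by rewrite /series/= !big_nat_recr //= big_nil add0r /exp_coeff/= !factS fact0
    expr0 expr1 !divr1 muln1.
rewrite /expR; apply: nondecreasing_cvgn_le; last exact:
  is_cvg_series_exp_coeff.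
by apply: nondecreasing_series => n _ _; exact: exp_coeff_ge0.
Qed.

Lemma flat_le0 P y : y <= 0 -> flat P y = 0.
Proof. by rewrite /flat ltNge => ->. Qed.

Lemma flat1E y : 0 < y -> flat 1 y = expR (- y^-1).
Proof. by move=> y0; rewrite /flat y0 hornerC mul1r. Qed.

Lemma dflat1 : dflat (1 : {poly R}) = 'X^2.
Proof. by rewrite /dflat derivC subr0 mulr1. Qed.

Lemma flat1_ge0 y : 0 <= flat 1 y.
Proof. by rewrite /flat; case: ifP => // _; rewrite hornerC mul1r expR_ge0. Qed.

Lemma flat1_le y : y <= 2^-1 -> flat 1 y <= flat 1 (2^-1 : R).
Proof.
move=> y2; have [y0|y0] := leP y 0; first by rewrite flat_le0// flat1_ge0.
by rewrite !flat1E ?invr_gt0// ler_expR lerN2 lef_pV2 ?posrE ?invr_gt0.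
Qed.

Lemma flat_dflat1_ge0 y : 0 <= flat (dflat 1) y.
Proof.
rewrite dflat1 /flat; case: ifP => // _.
by rewrite hornerXn mulr_ge0 ?sqr_ge0 ?expR_ge0.
Qed.

(** Here $E''(y)=(y^{-4}-2y^{-3})e^{-1/y}$, and $y\le1/2$ means $1/y\ge2$. *)
Lemma flat_dflat2_ge0 y : y <= 2^-1 -> 0 <= flat (dflat (dflat 1)) y.
Proof.
move=> y2; rewrite dflat1 /dflat /flat; case: ifP => // y0.
apply: mulr_ge0; last exact: expR_ge0.
rewrite derivXn !hornerE /=.
have z2 : 2 <= y^-1 by rewrite -[2]invrK lef_pV2 ?posrE ?invr_gt0.
nra.
Qed.

(** The tangent at [y] lies below the graph at 1/2. With $z=1/y-2\ge0$, division by $e^{-1/y}$ turns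
    this into $z+z^2/2\le e^z-1$. *)
Lemma flat1_convex y : y <= 2^-1 ->
  flat (dflat 1) y * (2^-1 - y) <= flat 1 (2^-1 : R) - flat 1 y.
Proof.
move=> y2; have [y0|y0] := leP y 0.
  by rewrite !(@flat_le0 _ y)// mul0r subr0 flat1_ge0.
rewrite !flat1E ?invr_gt0// dflat1 /flat y0 hornerXn invrK.
pose z := y^-1 - 2.
have z0 : 0 <= z by rewrite subr_ge0 -[2]invrK lef_pV2 ?posrE ?invr_gt0.
have -> : expR (- 2 : R) = expR (- y^-1) * expR z by rewrite -expRD /z; congr
  expR; ring.
have -> : y^-1 ^+ 2 * expR (- y^-1) * (2^-1 - y) = expR (- y^-1) * (z + z ^+ 2
  / 2).
  by rewrite /z; field; rewrite gt_eqF.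
rewrite -[X in _ - X]mulr1 -mulrBr ler_wpM2l ?expR_ge0//.
have := expR_ge1Dx2 z0; lra.
Qed.

(** The range up to 1 leaves room above 1/2 for approximations of an argument that is at most
    1/2. *)
Lemma flat_bounded P : exists2 K : R, 0 < K & forall y, y <= 1 -> `|flat P y|
  <= K.
Proof.
have [K K0 HK] := flat_le P; exists K => // y y1.
have [y0|y0] := leP y 0; first by rewrite flat_le0// normr0 ltW.
apply: (le_trans (HK y)); rewrite -[leRHS]mulr1 ler_wpM2l ?(ltW K0)//.
by rewrite expr_le1// ltW.
Qed.

Lemma flat_lipschitz P : exists2 K : R, 0 < K & forall a b, a <= 1 -> b <= 1 ->
  `|flat P a - flat P b| <= K * `|a - b|.
Proof.
have [K K0 HK] := flat_bounded (dflat P); exists K => //.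
suff H a b : a < b -> b <= 1 -> `|flat P b - flat P a| <= K * `|b - a|.
  move=> a b a1 b1; have [ab|ba|->] := ltgtP a b.
  - by rewrite distrC (distrC a) H.
  - exact: H.
  - by rewrite !subrr normr0 mulr0.
move=> ab b1.
have cf : {within `[a, b], continuous (flat P)}.
  by apply: derivable_within_continuous => t _; have [] := is_derive_flat P t.
have [t tab ->] := MVT ab (fun t _ => is_derive_flat P t) cf.
rewrite normrM ler_wpM2r// HK//.
by move: tab; rewrite in_itv/= => /andP[_ /ltW /le_trans]; apply.
Qed.

End flat_inequalities.

Section germs.
Context {R : realType} {d : nat}.
Local Notation E := 'rV[R]_d.
Implicit Types (f g : E -> R) (x : E) (i j : 'I_d).

Lemma partial_cst i (c : R) x : partial i (fun=> c) x = 0.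
Proof. exact: derive_cst. Qed.

Lemma near_eq_partial i f g x : (\forall y \near x, f y = g y) ->
  partial i f x = partial i g x.
Proof. by move=> fg; exact: near_eq_derive. Qed.

Lemma near_eq_partial2 i j f g x : (\forall y \near x, f y = g y) ->
  partial i (partial j f) x = partial i (partial j g) x.
Proof.
move=> /nbhs_interior fg; apply: near_eq_partial.
by move: fg; apply: filterS => y; exact: near_eq_partial.
Qed.

Lemma eq_Lop (A C : E -> 'M[R]_d) (H : E -> E) f g x :
  (forall i, partial i f x = partial i g x) ->
  (forall i j, partial i (partial j f) x = partial i (partial j g) x) ->
  Lop A C H f x = Lop A C H g x.
Proof.
move=> h1 h2; apply: (@f_equal2 _ _ _ (fun a b : R => 2^-1 * a + b)).
  by apply: eq_bigr => i _; apply: eq_bigr => j _; apply: congr1; exact: h2.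
by apply: eq_bigr => i _; apply: congr1; exact: h1.
Qed.

Lemma near_eq_Lop (A C : E -> 'M[R]_d) (H : E -> E) f g x :
  (\forall y \near x, f y = g y) -> Lop A C H f x = Lop A C H g x.
Proof.
move=> fg; apply: eq_Lop => [i|i j].
  exact (near_eq_partial i fg).
exact (near_eq_partial2 i j fg).
Qed.

Lemma Lop_cst A C H (c : R) x : Lop A C H (fun=> c) x = 0.
Proof.
rewrite /Lop big1 ?mulr0 ?add0r; last first.
  move=> i _; apply: big1 => j _.
  rewrite (_ : partial j _ = fun=> 0); last by apply/funext => z; rewrite
    partial_cst.
  by rewrite partial_cst mulr0.
by apply: big1 => i _; rewrite partial_cst mulr0.
Qed.

End germs.

Section flat_truncation.
Context {R : realType} {d : nat}.
Local Notation E := 'rV[R]_d.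
Variable k : R.
Implicit Types (f g : E -> R) (x : E) (i j : 'I_d).

Definition flat_arg f x : R := 2^-1 - k * f x.
(** The function $w$ of the overview. *)
Definition flat_trunc f x : R := flat 1 (flat_arg f x).

Lemma continuous_flat_trunc f : continuous f -> continuous (flat_trunc f).
Proof.
move=> cf; have ca : continuous (flat_arg f).
  rewrite (_ : flat_arg f = fun x => 2^-1 + (- k) * f x).
    exact: continuous_affine.
  by apply/funext => z; rewrite /flat_arg mulNr.
move=> x; apply: (@continuous_comp _ _ _ (flat_arg f) (flat 1)); first exact:
  ca.
apply/differentiable_continuous/derivable1_diffP.
by have [] := is_derive_flat 1 (flat_arg f x).
Qed.

Lemma is_derive_flat_arg P f i x : Ck 1 f -> is_derive x (delta_mx 0 i)
  (fun x => flat P (flat_arg f x)) (- k * flat (dflat P) (flat_arg f x) *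
    partial i f x).
Proof.
move=> f1.
have D1 : is_derive x (delta_mx 0 i) (flat_arg f) (- k * partial i f x).
  rewrite (_ : flat_arg f = cst 2^-1 + (- k) \*: f); last first.
    by apply/funext => z; rewrite /flat_arg -mulNr.
  by apply: (is_derive_eq (is_deriveD (is_derive_cst _ _ _)
    (is_deriveZ (- k) (Ck_is_derive i x f1)))); rewrite add0r.
by apply: (is_derive_eq (is_derive_comp D1 (is_derive_flat P (flat_arg f x))));
  ring.
Qed.

Lemma partial_trunc f i x : Ck 1 f ->
  partial i (flat_trunc f) x = - k * flat (dflat 1) (flat_arg f x) * partial i
    f x.
Proof. by move=> f1; exact: (partialE (is_derive_flat_arg 1 i x f1)). Qed.

Lemma partial2_trunc f i j x : Ck 2 f ->
  partial i (partial j (flat_trunc f)) x =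
  k ^+ 2 * flat (dflat (dflat 1)) (flat_arg f x) * (partial i f x * partial j f
    x) -
  k * flat (dflat 1) (flat_arg f x) * partial i (partial j f) x.
Proof.
move=> f2; have f1 := CkS f2.
have -> : partial j (flat_trunc f) =
    ((- k) \*: (fun x => flat (dflat 1) (flat_arg f x))) * partial j f.
  by apply/funext => z; rewrite partial_trunc.
have fj1 : Ck 1 (partial j f) := (f2.2 j).2.
apply: partialE; apply: (is_derive_eq (is_deriveM
  (is_deriveZ (- k) (is_derive_flat_arg (dflat 1) i x f1))
  (@Ck_is_derive _ _ 0 _ i x fj1))).
rewrite /GRing.scale/= -[_ *: _]/(_ * _).
by move: (flat _ _) (flat _ _) (partial i _ x) (partial i _ x) => a b u v; ring.
Qed.

Lemma Lop_trunc (A C : E -> 'M[R]_d) (H : E -> E) f x : Ck 2 f ->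
  Lop A C H (flat_trunc f) x =
  k ^+ 2 * flat (dflat (dflat 1)) (flat_arg f x) * (2^-1 * dot (mxv (A x) (grad
    f x)) (grad f x))
  - k * flat (dflat 1) (flat_arg f x) * Lop A C H f x.
Proof.
move=> f2; have f1 := CkS f2.
set e2 := flat (dflat (dflat 1)) _; set e1 := flat (dflat 1) _.
have S2 : \sum_i \sum_j A x i j * partial i (partial j (flat_trunc f)) x =
    k ^+ 2 * e2 * dot (mxv (A x) (grad f x)) (grad f x) -
    k * e1 * \sum_i \sum_j A x i j * partial i (partial j f) x.
  apply: (@etrans _ _ (\sum_i \sum_j A x i j * (k ^+ 2 * e2 *
      (partial i f x * partial j f x) - k * e1 * partial i (partial j f) x))).
    apply: eq_bigr => i _; apply: eq_bigr => j _; apply: congr1.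
    exact: partial2_trunc.
  rewrite /dot !mulr_sumr -sumrB; apply: eq_bigr => i _.
  rewrite !mxE mulr_suml !mulr_sumr -sumrB; apply: eq_bigr => j _.
  rewrite !mxE; move: (A x i j) (partial i f x) (partial j f x) => a b c.
  by move: (partial i _ x) => q; ring.
have S1 : \sum_i drift A C H x 0 i * partial i (flat_trunc f) x =
    - (k * e1) * \sum_i drift A C H x 0 i * partial i f x.
  apply: (@etrans _ _ (\sum_i drift A C H x 0 i * (- k * e1 * partial i f x))).
    apply: eq_bigr => i _; apply: congr1; exact: partial_trunc.
  rewrite mulr_sumr; apply: eq_bigr => i _.
  by move: (drift A C H x 0 i) (partial i f x) => a b; ring.
apply: (etrans (f_equal2 (fun a b : R => 2^-1 * a + b) S2 S1)).
rewrite /Lop; move: (dot _ _) => a.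
move: (\sum_i \sum_j A x i j * partial i (partial j f) x) => b.
by move: (\sum_i drift A C H x 0 i * partial i f x) => q; ring.
Qed.

End flat_truncation.

(** * Uniform convergence under products and flat functions *)

Section uniform_cvg.
Context {R : realType} {T : Type}.
Variable B : set T.
Implicit Types (F : nat -> T -> R) (G : T -> R).

Definition unif_cvg F G := forall e : R, 0 < e ->
  \forall n \near \oo, forall x, B x -> `|F n x - G x| <= e.

Definition bounded_on G := exists2 b : R, 0 < b & forall x, B x -> `|G x| <= b.

Lemma eq_unif_cvg F F' G G' : (forall n x, F n x = F' n x) ->
  (forall x, G x = G' x) -> unif_cvg F G -> unif_cvg F' G'.
Proof.
move=> FF' GG' H e /H; apply: filterS => n h x Bx.
by rewrite -FF' -GG'; exact: h.
Qed.

Lemma unif_cvgD F1 F2 G1 G2 : unif_cvg F1 G1 -> unif_cvg F2 G2 ->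
  unif_cvg (fun n x => F1 n x + F2 n x) (fun x => G1 x + G2 x).
Proof.
move=> H1 H2 e e0; have e2 : 0 < e / 2 by rewrite divr_gt0.
move: (H1 _ e2) (H2 _ e2); apply: filterS2 => n h1 h2 x Bx.
rewrite opprD addrACA (splitr e) (le_trans (ler_normD _ _))// lerD//.
  exact: h1.
exact: h2.
Qed.

Lemma unif_cvgZ (c : R) F G : unif_cvg F G -> unif_cvg (fun n x => c * F n x)
  (fun x => c * G x).
Proof.
move=> H e e0; have c1 : 0 < `|c| + 1 by rewrite ltr_wpDl.
have := H (e / (`|c| + 1)); rewrite divr_gt0// => /(_ isT); apply: filterS => n
  h x Bx.
rewrite -mulrBr normrM.
apply: (@le_trans _ _ ((`|c| + 1) * (e / (`|c| + 1)))).
  by apply: ler_pM => //; [rewrite lerDl|exact: h].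
by rewrite mulrC divfK// gt_eqF.
Qed.

Lemma unif_cvgM F1 F2 G1 G2 : bounded_on G1 -> bounded_on G2 -> unif_cvg F1 G1
  -> unif_cvg F2 G2 ->
  unif_cvg (fun n x => F1 n x * F2 n x) (fun x => G1 x * G2 x).
Proof.
move=> [b1 b10 B1] [b2 b20 B2] H1 H2 e e0.
pose c := b1 + b2 + 1.
have c0 : 0 < c by rewrite !addr_gt0.
pose s := Num.min 1 (e / c).
have s0 : 0 < s by rewrite lt_min ltr01 divr_gt0.
have s1 : s <= 1 by rewrite ge_min lexx.
have se : c * s <= e by rewrite mulrC -ler_pdivlMr// ge_min lexx orbT.
move: (H1 _ s0) (H2 _ s0); apply: filterS2 => n h1 h2 x Bx.
have -> : F1 n x * F2 n x - G1 x * G2 x = (F1 n x - G1 x) * (F2 n x - G2 x) +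
   (G1 x * (F2 n x - G2 x) + (F1 n x - G1 x) * G2 x) by ring.
apply: le_trans se; rewrite (le_trans (ler_normD _ _))//.
rewrite (_ : c * s = s * 1 + (b1 * s + s * b2)); last by rewrite /c; ring.
apply: lerD; first by rewrite normrM ler_pM// ?h1//; exact: le_trans (h2 _ Bx)
  s1.
rewrite (le_trans (ler_normD _ _))// !normrM lerD// ler_pM//.
- exact: B1.
- exact: h2.
- exact: h1.
- exact: B2.
Qed.

Lemma unif_cvg_flat P F G : (forall x, B x -> G x <= 2^-1) -> unif_cvg F G ->
  unif_cvg (fun n x => flat P (F n x)) (fun x => flat P (G x)).
Proof.
move=> G2 H e e0; have [K K0 HK] := flat_lipschitz P.
have h2 : (0 : R) < 2^-1 by rewrite invr_gt0.
have := H (e / K); rewrite divr_gt0// => /(_ isT).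
have := H _ h2; apply: filterS2 => n Hh He x Bx.
have := Hh x Bx; have := G2 x Bx => g2; rewrite ler_norml => /andP[_ f2].
apply: (le_trans (HK _ _ _ _)); [lra|lra|].
by rewrite -ler_pdivlMl// mulrC He.
Qed.

Lemma bounded_onM G1 G2 : bounded_on G1 -> bounded_on G2 ->
  bounded_on (fun x => G1 x * G2 x).
Proof.
move=> [b1 b10 B1] [b2 b20 B2]; exists (b1 * b2); first exact: mulr_gt0.
by move=> x Bx; rewrite normrM ler_pM// ?B1// B2.
Qed.

Lemma bounded_on_flat P G : (forall x, B x -> G x <= 2^-1) ->
  bounded_on (fun x => flat P (G x)).
Proof.
move=> G2; have [K K0 HK] := flat_bounded P; exists K => // x Bx.
by apply: HK; apply: (le_trans (G2 x Bx)); rewrite invf_le1// ler1n.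
Qed.

End uniform_cvg.

(** * Test functions close to the truncated Lyapunov function *)

Section test_approximation.
Context {R : realType} {d : nat}.
Local Notation E := 'rV[R]_d.
Variables (A C : E -> 'M[R]_d) (H : E -> E).
Variables (phi : E -> R) (k r : R).
Hypothesis phi2 : Ck 2 phi.
Hypothesis phi0 : forall x, 0 <= phi x.
Hypothesis k0 : 0 < k.
Hypothesis r0 : 0 < r.
Hypothesis phi_far : forall x : E, r <= `|x| -> 1 <= k * phi x.
Implicit Types (x : E) (i j : 'I_d).

(** Weight that converts a $C^2$ distance into a bound on $L$; locally integrable, though not
    locally bounded in general. *)
Definition coef_sum x : R := \sum_i \sum_j `|A x i j| + \sum_i `|drift A C H x
  0 i|.

Lemma Lop_close (f g : E -> R) x (e : R) : 0 <= e ->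
  (forall i, `|partial i f x - partial i g x| <= e) ->
  (forall i j, `|partial i (partial j f) x - partial i (partial j g) x| <= e) ->
  `|Lop A C H f x - Lop A C H g x| <= e * coef_sum x.
Proof.
move=> e0 h1 h2; rewrite /Lop opprD addrACA -mulrBr -!sumrB.
rewrite /coef_sum mulrDr (le_trans (ler_normD _ _))// lerD//.
  rewrite normrM ger0_norm ?invr_ge0// ler_pdivrMl//.
  apply: (@le_trans _ _ (e * \sum_i \sum_j `|A x i j|)).
    rewrite mulr_sumr (le_trans (ler_norm_sum _ _ _))//; apply: ler_sum => i _.
    rewrite -sumrB mulr_sumr (le_trans (ler_norm_sum _ _ _))//; apply: ler_sum
      => j _.
    by rewrite -mulrBr normrM mulrC ler_wpM2r.
  rewrite mulr_natl mulr2n lerDl mulr_ge0//.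
  by apply: sumr_ge0 => i _; apply: sumr_ge0.
rewrite mulr_sumr (le_trans (ler_norm_sum _ _ _))//; apply: ler_sum => i _.
by rewrite -mulrBr normrM mulrC ler_wpM2r.
Qed.

(** Requiring $k\varphi\ge1$ instead of 1/2 leaves a margin of 1/2: an approximation of the argument
    to within 1/2 is still nonpositive here. *)
Lemma flat_arg_far x : r <= `|x| -> flat_arg k phi x <= - 2^-1.
Proof. by move=> /phi_far; rewrite /flat_arg; lra. Qed.

Lemma flat_arg_le x : flat_arg k phi x <= 2^-1.
Proof. by rewrite /flat_arg gerBl mulr_ge0// ltW. Qed.

Lemma near_norm_gt x (s : R) : s < `|x| -> \forall y \near x, s < `|y|.
Proof.
move=> sx; have : \forall t \near `|x|, s < t by exact: lt_nbhsr.
exact: norm_continuous.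
Qed.

Lemma near_norm_lt x (s : R) : `|x| < s -> \forall y \near x, `|y| < s.
Proof.
move=> sx; have : \forall t \near `|x|, t < s by exact: lt_nbhsl.
exact: norm_continuous.
Qed.

Lemma trunc_far x : r < `|x| -> \forall y \near x, flat_trunc k phi y = 0.
Proof.
move=> rx; have := near_norm_gt rx; apply: filterS => y /ltW ry.
by rewrite /flat_trunc flat_le0// (le_trans (flat_arg_far ry))// oppr_le0
  invr_ge0.
Qed.

Lemma smooth_trunc (p : E -> R) : smooth p -> smooth (flat_trunc k p).
Proof.
move=> sp; have sa : smooth (flat_arg k p).
  move=> m; rewrite (_ : flat_arg k p = cst 2^-1 \+ (cst (- k) \* p)).
    exact (CkD (Ck_cst m _) (CkM (Ck_cst m _) (sp m))).
  by apply/funext => z; rewrite /flat_arg /= mulNr.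
apply: (@smooth_comp R d (range (@flat R)) (flat_arg k p) _ sa (flat 1)); last
  by exists 1.
move=> _ [P _ <-]; exists (flat (dflat P)); first by exists (dflat P).
by move=> y; exact: is_derive_flat.
Qed.

(** [p] resembles [phi] on the cube of radius [r + 1] only, so its truncation is set to 0 outside.
    Smoothness survives because the truncation already vanishes on the whole shell between [r] and
    [r + 1]. *)
Lemma test_fun_cutoff (p : E -> R) : smooth p ->
  (forall x, r <= `|x| -> `|x| <= r + 1 -> flat_arg k p x <= 0) ->
  exists u, [/\ test_fun setT u,
    forall x, `|x| < r + 1 -> \forall y \near x, u y = flat_trunc k p y &
    forall x, r < `|x| -> \forall y \near x, u y = 0].
Proof.
move=> sp pfar.
pose u x := if `|x| <= r + 1 then flat_trunc k p x else 0.
have u1 x : `|x| < r + 1 -> \forall y \near x, u y = flat_trunc k p y.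
  move=> xr; have := near_norm_lt xr; apply: filterS => y yr.
  by rewrite /u (ltW yr).
have u2 x : r < `|x| -> \forall y \near x, u y = 0.
  move=> xr; have := near_norm_gt xr; apply: filterS => y yr.
  rewrite /u; case: ifPn => // yr1; rewrite /flat_trunc flat_le0//.
  exact: pfar (ltW yr) yr1.
exists u; split=> //; split.
  move=> m; apply: Ck_local => x; have [xr|xr] := ltP `|x| (r + 1).
    by exists (flat_trunc k p); [exact: smooth_trunc|exact: u1].
  exists (cst 0); first exact: Ck_cst.
  by apply: u2; rewrite (lt_le_trans _ xr)// ltrDl.
exists (cube (r + 1)); split=> //; first exact: rV_ball_compact.
by move=> x /negP; rewrite /u /cube/= => /negbTE ->.
Qed.

(** The formulas for the first and second derivatives of [flat_trunc] are built from [flat] and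
    derivatives of the argument by sums and products, so uniform $C^2$ convergence to [phi] on the
    cube passes to the truncations. *)
Lemma trunc_approx (e : R) : 0 < e -> exists u, [/\ test_fun setT u,
  forall x, r < `|x| -> u x = 0 /\ Lop A C H u x = 0,
  forall x, `|u x - flat_trunc k phi x| <= e &
  forall x, `|x| < r + 1 ->
    `|Lop A C H u x - Lop A C H (flat_trunc k phi) x| <= e * coef_sum x].
Proof.
move=> e0; have r10 : 0 < r + 1 by rewrite addr_gt0.
have pP n : exists p, smooth p /\ forall x, `|x| <= r + 1 ->
  [/\ `|p x - phi x| <= n.+1%:R^-1,
   forall j, `|partial j p x - partial j phi x| <= n.+1%:R^-1 &
   forall i j, `|partial i (partial j p) x - partial i (partial j phi) x| <=
     n.+1%:R^-1].
  have n10 : (0 : R) < n.+1%:R^-1 by rewrite invr_gt0.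
  by have [p sp Hp] := C2_approx r10 phi2 n10; exists p.
have [p Hp] := choice pP.
pose B := cube (d := d) (r + 1).
have inv_small (s : R) : 0 < s -> \forall n \near \oo, (n.+1%:R^-1 : R) <= s.
  move=> s0; have := near_infty_natSinv_lt (PosNum s0); apply: filterS => n;
    exact: ltW.
have c0 : unif_cvg B p phi.
  move=> s s0; have := inv_small s s0; apply: filterS => n ns x Bx.
  by have [h _ _] := (Hp n).2 x Bx; exact: le_trans ns.
have c1 j : unif_cvg B (fun n => partial j (p n)) (partial j phi).
  move=> s s0; have := inv_small s s0; apply: filterS => n ns x Bx.
  by have [_ h _] := (Hp n).2 x Bx; exact: le_trans (h j) ns.
have c2 i j : unif_cvg B (fun n => partial i (partial j (p n))) (partial i
  (partial j phi)).
  move=> s s0; have := inv_small s s0; apply: filterS => n ns x Bx.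
  by have [_ _ h] := (Hp n).2 x Bx; exact: le_trans (h i j) ns.
have cB : compact B by exact: rV_ball_compact.
have b1 j : bounded_on B (partial j phi).
  by apply: compact_normr_bounded => //; exact: (phi2.2 j).2.1.
have b2 i j : bounded_on B (partial i (partial j phi)).
  by apply: compact_normr_bounded => //; exact: ((phi2.2 j).2.2 i).2.
have argl x : B x -> flat_arg k phi x <= 2^-1 by move=> _; exact: flat_arg_le.
have ca : unif_cvg B (fun n => flat_arg k (p n)) (flat_arg k phi).
  move=> s s0; have := unif_cvgZ k c0 s0; apply: filterS => n h x Bx.
  have -> : flat_arg k (p n) x - flat_arg k phi x = - (k * p n x - k * phi x).
    by rewrite /flat_arg; ring.
  by rewrite normrN; exact: h.
have cf P : unif_cvg B (fun n x => flat P (flat_arg k (p n) x)) (fun x => flat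
  P (flat_arg k phi x)).
  exact: unif_cvg_flat.
have bf P : bounded_on B (fun x => flat P (flat_arg k phi x)) by exact:
  bounded_on_flat.
have d1 j : unif_cvg B (fun n => partial j (flat_trunc k (p n))) (partial j
  (flat_trunc k phi)).
  have E1 (f : E -> R) x : Ck 1 f ->
      - k * (flat (dflat 1) (flat_arg k f x) * partial j f x) = partial j
          (flat_trunc k f) x.
    by move=> f1; rewrite mulrA; exact/esym/partial_trunc.
  have U := unif_cvgZ (- k) (unif_cvgM (bf (dflat 1)) (b1 j) (cf (dflat 1)) (c1
    j)).
  exact (eq_unif_cvg (fun n x => E1 (p n) x ((Hp n).1 1%N)) (fun x => E1 phi x
    (CkS phi2)) U).
have d2 i j : unif_cvg B (fun n => partial i (partial j (flat_trunc k (p n))))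
   (partial i (partial j (flat_trunc k phi))).
  have E2 (f : E -> R) x : Ck 2 f ->
      k ^+ 2 * (flat (dflat (dflat 1)) (flat_arg k f x) *
        (partial i f x * partial j f x)) +
        - k * (flat (dflat 1) (flat_arg k f x) * partial i (partial j f) x) =
      partial i (partial j (flat_trunc k f)) x.
    by move=> f2; rewrite mulNr !mulrA; apply: esym; rewrite partial2_trunc//
      !mulrA.
  have U := unif_cvgD
    (unif_cvgZ (k ^+ 2) (unif_cvgM (bf (dflat (dflat 1))) (bounded_onM (b1 i)
      (b1 j))
      (cf (dflat (dflat 1))) (unif_cvgM (b1 i) (b1 j) (c1 i) (c1 j))))
    (unif_cvgZ (- k) (unif_cvgM (bf (dflat 1)) (b2 i j) (cf (dflat 1)) (c2 i
      j))).
  exact (eq_unif_cvg (fun n x => E2 (p n) x ((Hp n).1 2%N)) (fun x => E2 phi x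
    phi2) U).
have h2 : (0 : R) < 2^-1 by rewrite invr_gt0.
have D1 : \forall n \near \oo, forall j x, B x ->
    `|partial j (flat_trunc k (p n)) x - partial j (flat_trunc k phi) x| <= e.
  by apply: filter_forall => j; exact: d1.
have D2 : \forall n \near \oo, forall i j x, B x ->
    `|partial i (partial j (flat_trunc k (p n))) x -
      partial i (partial j (flat_trunc k phi)) x| <= e.
  by apply: filter_forall => i; apply: filter_forall => j; exact: d2.
have [N _ HN] := filterI (filterI (ca _ h2) (cf 1 _ e0)) (filterI D1 D2).
have [[/= N1 N2] [N3 N4]] := HN N (leqnn N).
have [|u [tu u1 u2]] := @test_fun_cutoff (p N) (Hp N).1.
  move=> x /flat_arg_far a1 a2; have := N1 x a2; rewrite ler_norml => /andP[_
    a3]; lra.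
exists u; split=> //.
- move=> x xr; split; first exact: nbhs_singleton (u2 x xr).
  by rewrite (near_eq_Lop A C H (u2 x xr)) Lop_cst.
- move=> x; have [xr|xr] := ltP `|x| (r + 1).
    by rewrite (nbhs_singleton (u1 x xr)); apply: N2; exact: ltW.
  have xr' : r < `|x| by rewrite (lt_le_trans _ xr)// ltrDl.
  by rewrite (nbhs_singleton (u2 x xr')) (nbhs_singleton (trunc_far xr')) subrr
    normr0 ltW.
- move=> x xr; rewrite (near_eq_Lop A C H (u1 x xr)); apply: Lop_close; first
    exact: ltW.
    by move=> i; apply: N3; exact: ltW.
  by move=> i j; apply: N4; exact: ltW.
Qed.

End test_approximation.

(** * The differential inequality and its transfer to the semigroup *)

Section lyapunov_semigroup.
Context {R : realType} {d : nat}.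
Local Notation E := 'rV[R]_d.
Local Notation leb := (@lebesgue_rV R d).
Variables (p : R) (A C : E -> 'M[R]_d) (H : E -> E).
Hypothesis hd : (2 <= d)%N.
Hypothesis hp : d%:R < p.
Hypothesis ha : assumption_a p A C H.
Hypothesis hb : assumption_b p A C H.
Variables (rho : E -> R) (mu : {measure set E -> \bar R}).
Hypothesis hrho : invariant_density p A C H rho mu.
Variable T : R -> (E -> R) -> E -> R.
Hypothesis hT : L1_semigroup A C H rho mu T.
Variables (phi : E -> R) (M : R).
Hypothesis phi2 : Ck 2 phi.
Hypothesis phi0 : forall x, 0 <= phi x.
Hypothesis M0 : 0 < M.
Hypothesis hL : {ae leb, forall x, Lop A C H phi x <= M * phi x}.
Variables (k r : R).
Hypothesis k0 : 0 < k.
Hypothesis r0 : 0 < r.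
Hypothesis phi_far : forall x : E, r <= `|x| -> 1 <= k * phi x.
Local Notation L1 f := (mu.-integrable [set: E] (EFin \o f)).
Local Notation c := (flat 1 (2^-1) : R).
Implicit Types (x : E).

Lemma dot_A_ge0 x xi : 0 <= dot (mxv (A x) xi) xi.
Proof.
have [|nu nu0 /(_ xi x erefl)/andP[+ _]] := A_elliptic ha (V := [set x]).
  by apply: compact_precompact; [exact: norm_hausdorff|exact: compact_set1].
by apply: le_trans; rewrite mulr_ge0 ?invr_ge0 ?(ltW nu0) ?sqr_ge0.
Qed.

(** On the cube, [Lop_trunc] splits off a nonnegative quadratic term, and [flat1_convex] with
    $1/2-y=k\varphi$ handles the rest. Outside, $w$ and $Lw$ vanish, so the indicator can stand in
    for the constant 1. *)
Lemma Lop_trunc_ge : {ae leb, forall x,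
  M * flat_trunc k phi x - M * c * \1_(cube r) x <= Lop A C H (flat_trunc k
    phi) x}.
Proof.
move: hL; apply: filterS => x Lx.
have [xr|xr] := leP `|x| r; last first.
  rewrite (near_eq_Lop A C H (trunc_far phi_far xr)) Lop_cst.
  rewrite (nbhs_singleton (trunc_far phi_far xr)) mulr0 sub0r oppr_le0.
  by rewrite !mulr_ge0 ?flat1_ge0// ltW.
rewrite indicE mem_set//= mulr1 Lop_trunc//.
have y2 := flat_arg_le phi0 k0 x; set y := flat_arg k phi x in y2 *.
have e1 := flat_dflat1_ge0 y; have e2 := flat_dflat2_ge0 y2.
have conv := flat1_convex y2.
have I1 : 0 <= k ^+ 2 * flat (dflat (dflat 1)) y *
    (2^-1 * dot (mxv (A x) (grad phi x)) (grad phi x)).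
  apply: mulr_ge0; first exact: mulr_ge0 (sqr_ge0 k) e2.
  by apply: mulr_ge0; [rewrite invr_ge0|exact: dot_A_ge0].
have I2 : k * flat (dflat 1) y * Lop A C H phi x <= k * flat (dflat 1) y * (M *
  phi x).
  by apply: ler_wpM2l => //; rewrite mulr_ge0// ltW.
have I3 : k * flat (dflat 1) y * (M * phi x) = M * (flat (dflat 1) y * (2^-1 -
  y)).
  by rewrite /y /flat_arg; ring.
have I4 := ler_wpM2l (ltW M0) conv.
have -> : flat_trunc k phi x = flat 1 y by [].
rewrite mulrBr in I4; lra.
Qed.

Lemma L1_trunc : L1 (flat_trunc k phi).
Proof.
have [] := @L1_bounded _ _ rho mu (rho_continuous hrho) (rho_gt0 hrho)
  (mu_density hrho) (flat_trunc k phi) r c => //.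
- by apply: continuous_measurable_rV;
    exact/continuous_flat_trunc/(Ck_continuous phi2).
- move=> x _; rewrite ger0_norm ?flat1_ge0//; apply: flat1_le; exact:
    flat_arg_le.
- by move=> x xr; rewrite (nbhs_singleton (trunc_far phi_far xr)).
Qed.

Lemma L1_cube s : L1 (\1_(cube s)).
Proof.
have [] := @L1_bounded _ _ rho mu (rho_continuous hrho) (rho_gt0 hrho)
  (mu_density hrho) (\1_(cube s)) s 1 => //.
- by apply: measurable_indic; exact: measurable_cube.
- by move=> x xr; rewrite indicE mem_set//= normr1.
- by move=> x xr; rewrite indicE memNset//= /cube/= => xs; rewrite ltNge xs in
    xr.
Qed.

Lemma L1_coef s : L1 (fun x => \1_(cube s) x * coef_sum A C H x).
Proof.
have -> : (fun x => \1_(cube s) x * coef_sum A C H x) = (fun x =>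
  \sum_i \sum_j \1_(cube s) x * `|A x i j| +
  \sum_i \1_(cube s) x * `|drift A C H x 0 i|).
  apply/funext => x; rewrite /coef_sum mulrDr !mulr_sumr; congr (_ + _).
  by apply: eq_bigr => i _; rewrite mulr_sumr.
apply: L1_add; apply: L1_sum => i.
  apply: L1_sum => j; apply: (L1_cube_Lploc (rho_continuous hrho)
    (rho_gt0 hrho) (mu_density hrho) _ (q := 2)); first by rewrite ler1n.
  by have [[]] := A_regular ha i j.
apply: (L1_cube_Lploc (rho_continuous hrho) (rho_gt0 hrho) (mu_density hrho) _
  _ (hb i)).
(* The exponent $pd/(p+d)$ is at least 1, since $p>d\ge2$ gives $p(d-1)\ge d$. *)
have d2 : (2 : R) <= d%:R by rewrite ler_nat.
have := hp; move: (d%:R : R) d2 => D D2 Dp.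
have pD0 : 0 < p + D by lra.
rewrite ler_pdivlMr// mul1r; nra.
Qed.

Theorem semigroup_trunc_le t : 0 < t ->
  {ae mu, forall x, c - T t (flat_trunc k phi) x <=
     expR (M * t) * (c - flat_trunc k phi x)}.
Proof.
move=> t0; have wL1 := L1_trunc.
apply: (lyapunov_comparison (L1_semigroup_C0 hT) wL1 _ (L1_cube r)) => //.
- by move=> x; apply: flat1_le; exact: flat_arg_le.
- by move=> x; rewrite indicE; case: (_ \in _); rewrite /= ?lexx ?ler01.
- exact: flat1_ge0.
- exact: ltW.
move=> e e0.
pose G x := \1_(cube (r + 1)) x * coef_sum A C H x.
have G0 x : 0 <= G x.
  rewrite mulr_ge0// /coef_sum addr_ge0// sumr_ge0// => i _; exact: sumr_ge0.
have G1 : L1 G by exact: L1_coef.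
have [K1 K1G] : exists K1, L1_small mu G K1.
  exists (fine (\int[mu]_x (G x)%:E)); split=> //.
  rewrite fineK//; apply: integrable_fin_num => //.
have C1 := L1_cube (r + 1).
have cube_ge0 x : 0 <= \1_(cube (r + 1)) x :> R by [].
have [K2 K2C] : exists K2, L1_small mu (\1_(cube (r + 1))) K2.
  exists (fine (\int[mu]_x (\1_(cube (r + 1)) x)%:E)); split=> //.
  rewrite fineK//; exact: integrable_fin_num.
have K10 := L1_small_bound_ge0 K1G; have K20 := L1_small_bound_ge0 K2C.
(* [K1 + M * K2] accounts for replacing $Lw$ and $Mw$ by $Lu$ and $Mu$, [K2] for the distance of $u$
   to $w$; the 1 makes [K] positive. *)
pose K := K1 + M * K2 + K2 + 1.
have K0 : 0 < K by rewrite /K; have := mulr_ge0 (ltW M0) K20; lra.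
pose s := e / K.
have s0 : 0 < s by rewrite divr_gt0.
have sK : s * K = e by rewrite /s divfK// gt_eqF.
have [u [tu u0 uw uL]] := trunc_approx A C H phi2 phi0 k0 r0 phi_far s0.
have guL := L1_semigroup_extends hT tu.
have [/inLpT1 u1 _ _] := guL.
exists u, (Lop A C H u), (fun x => s * (G x + M * \1_(cube (r + 1)) x));
  split=> //.
- apply: L1_small_le (L1_small_scale (ltW s0) (L1_small_add K1G (L1_small_scale
    (ltW M0) K2C))).
  by rewrite -[leRHS]sK ler_wpM2l ?(ltW s0)// /K; lra.
- have wu1 : L1 (fun x => flat_trunc k phi x - u x) by exact: L1_sub.
  apply: (@le_trans _ _ (\int[mu]_x (s * \1_(cube (r + 1)) x)%:E)%E).
    apply: ge0_le_integral => //.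
    + by have /integrableP[/measurable_EFinP mwu _] := wu1;
        apply/measurable_EFinP; exact: measurableT_comp.
    + by have /integrableP[] := L1_scale s C1.
    + move=> x _; rewrite lee_fin indicE.
      have [xr|xr] := leP `|x| (r + 1); first by rewrite mem_set//= mulr1
        distrC.
      have xr' : r < `|x| by rewrite (lt_trans _ xr)// ltrDl.
      rewrite (u0 x xr').1 (nbhs_singleton (trunc_far phi_far xr')) subrr
        normr0.
      by rewrite mulr_ge0// ltW.
  have [_ _ /le_trans] := L1_small_scale (ltW s0) K2C; apply.
  rewrite lee_fin -[leRHS]sK ler_wpM2l ?(ltW s0)// /K.
  by have := mulr_ge0 (ltW M0) K20; lra.
have := ae_lebesgue_mu (rho_continuous hrho) (mu_density hrho) Lop_trunc_ge.
apply: filterS => x Lw.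
have i0 : 0 <= \1_(cube r) x :> R by [].
have [xr|xr] := leP `|x| r; last first.
  have [-> ->] := u0 x xr.
  have := mulr_ge0 (ltW s0) (addr_ge0 (G0 x) (mulr_ge0 (ltW M0) (cube_ge0 x))).
  have := mulr_ge0 (mulr_ge0 (ltW M0) (flat1_ge0 2^-1)) i0.
  rewrite mulr0; lra.
have xr1 : `|x| < r + 1 by rewrite (le_lt_trans xr)// ltrDl.
have := uL x xr1; have := uw x.
rewrite /G (_ : \1_(cube (r + 1)) x = 1); last first.
  by rewrite indicE mem_set//; exact: ltW.
rewrite !ler_norml !mul1r mulr1 => /andP[_ w2] /andP[l1 _].
have := ler_wpM2l (ltW M0) w2.
rewrite mulrDr; lra.
Qed.

End lyapunov_semigroup.

(** * The process *)

Section trunc_bounds.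
Context {R : realType}.
Local Notation c := (flat 1 (2^-1) : R).

Lemma flat1_half_gt0 : 0 < c.
Proof. by rewrite flat1E ?invr_gt0// expR_gt0. Qed.

(** From $1/(1/2-q)=2+4q/(1-2q)$. *)
Let flat1_sub (q : R) : 2 * q < 1 ->
  flat 1 (2^-1 - q) = c * expR (- (4 * q / (1 - 2 * q))).
Proof.
move=> q1; have q2 : 0 < 2^-1 - q by lra.
rewrite !flat1E ?invr_gt0//.
rewrite -expRD; congr expR; field.
by rewrite !gt_eqF; lra.
Qed.

Lemma flat1_sub_le (q : R) : 0 <= q -> 2 * q < 1 ->
  c - flat 1 (2^-1 - q) <= c * (4 * q / (1 - 2 * q)).
Proof.
move=> q0 q1; rewrite flat1_sub// -[X in X - _]mulr1 -mulrBr.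
apply: ler_wpM2l; first exact: flat1_ge0.
by have := expR_ge1Dx (- (4 * q / (1 - 2 * q))); lra.
Qed.

(** Follows from $e^z\ge1+z\ge1+4q$ for $z=4q/(1-2q)$. It must hold for arbitrarily large [q], since
    [phi] is unbounded along the process, hence a bound that saturates at [c]. *)
Lemma flat1_sub_ge (q : R) : 0 <= q ->
  c * (4 * q / (1 + 4 * q)) <= c - flat 1 (2^-1 - q).
Proof.
move=> q0; have q4 : 0 < 1 + 4 * q by lra.
have [q1|q1] := ltP (2 * q) 1; last first.
  rewrite (@flat_le0 _ _ (2^-1 - q)) ?subr0; last by lra.
  rewrite -[leRHS]mulr1 ler_wpM2l ?flat1_ge0// ler_pdivrMr//; lra.
rewrite flat1_sub// -[X in X - _]mulr1 -mulrBr.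
apply: ler_wpM2l; first exact: flat1_ge0.
have q2 : 0 < 1 - 2 * q by lra.
pose z := 4 * q / (1 - 2 * q); rewrite -/z.
have z0 : 0 <= z by rewrite divr_ge0 ?mulr_ge0// ltW.
have zq : 4 * q <= z by rewrite ler_pdivlMr//; nra.
rewrite expRN lerBrDl -lerBrDr.
have -> : 1 - 4 * q / (1 + 4 * q) = (1 + 4 * q)^-1 by field; rewrite gt_eqF.
rewrite lef_pV2 ?posrE ?expR_gt0//.
apply: le_trans (expR_ge1Dx z); lra.
Qed.

End trunc_bounds.

Section cemetery.
Context {R : realType} {d : nat}.
Local Notation E := 'rV[R]_d.
Local Notation S := (one_point_compactification 'rV[R]_d).

Lemma measurable_Some_open (U : set E) : open U -> measurable (Some @` U : set
  S).
Proof.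
by move=> oU; apply: sub_sigma_algebra; exact:
  one_point_compactification_open_some.
Qed.

Lemma measurable_at_cemetery0 (f : E -> R) : continuous f -> (forall x, 0 <= f
  x) ->
  measurable_fun setT (at_cemetery0 f).
Proof.
move=> cf f0; apply: (measurability _ (RGenOInfty.measurableE R)) => //.
move=> _ [_ [a ->] <-]; rewrite setTI.
have [a0|a0] := ltP a 0.
  rewrite (_ : _ @^-1` _ = setT)//; apply/seteqP; split=> // -[x|] _ /=;
    by rewrite in_itv/= andbT// (lt_le_trans a0).
rewrite (_ : _ @^-1` _ = Some @` [set x | a < f x]).
  apply: measurable_Some_open; apply: (@open_comp _ _ f [set y | a < y]).
    by move=> x _; exact: cf.
  exact: open_gt.
apply/seteqP; split=> [[x|]|y] /=.
- by rewrite in_itv/= andbT => ax; exists x.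
- by rewrite in_itv/= andbT ltNge a0.
- by move=> [x ax <-] /=; rewrite in_itv/= ax.
Qed.

Lemma measurable_cemetery : measurable ([set None] : set S).
Proof.
rewrite (_ : [set None] = ~` (Some @` [set: E])).
  by apply: measurableC; apply: measurable_Some_open; exact: openT.
by apply/seteqP; split=> [y -> [x]|[x|]] //= H; exfalso; apply: H; exists x.
Qed.

Lemma norm_le_enorm (x : E) : `|x| <= enorm x.
Proof.
rewrite rV_norm_le ?sqrtr_ge0//; apply/forallP => i.
rewrite -sqrtr_sqr ler_wsqrtr// /dot (bigD1 i)//= -expr2 lerDl.
by apply: sumr_ge0 => j _; rewrite -expr2 sqr_ge0.
Qed.

(** The infima run over Euclidean spheres and [r] refers to the sup norm; [norm_le_enorm] is the
    needed direction. *)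
Lemma coercive_far (phi : E -> R) (k : R) : (forall x, 0 <= phi x) -> 0 < k ->
  inf [set phi x | x in [set x | enorm x = r]] @[r --> +oo] --> +oo ->
  exists2 r, 0 < r & forall x : E, r <= `|x| -> 1 <= k * phi x.
Proof.
move=> phi0 k0 /cvgryPge/(_ k^-1) [M [_ HM]].
exists (`|M| + 1); first by rewrite ltr_wpDl.
move=> x xM; rewrite -ler_pdivrMl// mulr1.
have Mx : M < enorm x.
  apply: (lt_le_trans _ (norm_le_enorm x)); apply: lt_le_trans xM.
  by rewrite (le_lt_trans (ler_norm M))// ltrDl.
apply: (le_trans (HM _ Mx)); apply: ge_inf; last by exists x.
by exists 0 => _ [y _ <-].
Qed.

End cemetery.

Section transition_bound.
Context {R : realType} {d : nat}.
Local Notation E := 'rV[R]_d.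
Variables (mu : {measure set E -> \bar R}) (T P : R -> (E -> R) -> E -> R).
Hypothesis hT : sub_markovian_C0_semigroup mu setT T.
Hypothesis hP : transition_function mu T P.

Lemma inLp_bounded (f : E -> R) (K : R) : measurable_fun setT f ->
  (forall x, `|f x| <= K) -> inLp mu setT +oo%E f.
Proof.
move=> mf fK; split=> //; rewrite /LnormV patch_setT Lnorm.unlock.
case: ifPn => // _; apply: (@le_lt_trans _ _ K%:E); last exact: ltry.
by apply/ess_supP; apply: nearW => x; rewrite /= lee_fin.
Qed.

(** As [f] lies in $L^1\cap L^\infty$, the constant sequence [f] is admissible in the definition of
    the extended semigroup, so the constant sequence [T t f] converges to [P t f] in $L^1$. *)
Lemma transition_ae_eq t (f : E -> R) (K : R) : 0 < t ->
  inLp mu setT 1%E f -> (forall x, `|f x| <= K) ->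
  continuous (P t f) /\ {ae mu, forall x, P t f x = T t f x}.
Proof.
move=> t0 f1 fK; have [cP [P1 /= H]] := hP.2 1%E t f (lexx _) t0 f1.
split=> //.
have Lf : forall n : nat, L1Loo mu ((fun=> f) n).
  by move=> _; split=> //; exact: inLp_bounded f1.1 fK.
have Z : LnormV mu setT 1 (fun x => f x - f x) = 0%E.
  by rewrite LnormT1; apply: integral0_eq => x _; rewrite subrr normr0.
have cf : cvgLp mu setT 1%E (fun=> f) f.
  by rewrite /cvgLp Z; exact: cvg_cst.
have := H _ Lf cf; rewrite /cvgLp => cT.
have T1 : inLp mu setT 1 (T t f) := semigroup_L1 hT t0 f1.
have N0 : LnormV mu setT 1 (fun x => T t f x - P t f x) = 0%E.
  by rewrite -(cvg_lim (@ereal_hausdorff R) cT) lim_cst.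
rewrite LnormT1 in N0.
have mD : measurable_fun setT (fun x => (T t f x - P t f x)%:E).
  by apply/measurable_EFinP; apply: measurable_funB; [exact: T1.1|exact: P1.1].
have /(ae_eq_integral_abs mu measurableT mD) := N0.
apply: filterS => x /(_ Logic.I) [] /eqP; rewrite subr_eq0 => /eqP ->.
by [].
Qed.

End transition_bound.

Section process_bound.
Context {R : realType} {d : nat} {dO : measure_display} {Omega : measurableType
  dO}.
Local Notation E := 'rV[R]_d.
Local Notation S := (one_point_compactification 'rV[R]_d).
Local Notation c := (flat 1 (2^-1) : R).
Variables (Pr : S -> probability Omega R) (F : R -> set (set Omega)).
Variables (X : R -> Omega -> S) (P : R -> (E -> R) -> E -> R).
Hypothesis hM : hunt_process Pr F X.
Hypothesis hMP : has_transition_function Pr X P.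
Implicit Types (t : R).

Lemma measurable_process t : 0 <= t -> measurable_fun setT (X t).
Proof.
move=> t0 _ B mB; rewrite setTI.
by apply: (filtration_measurable hM t0); exact: (process_adapted hM).
Qed.

(* [c - w] on the state space and [c] at the cemetery bound the expectation of
   any observable [g] dominated by them. *)
Lemma expectation_le t x (w : E -> R) (g : Omega -> R) (K : R) :
  0 <= t -> continuous w -> (forall y, 0 <= w y <= c) ->
  measurable_fun setT g -> (forall o, 0 <= g o) ->
  (forall o, g o + at_cemetery0 w (X t o) <= c) ->
  c - P t w x <= K -> (\int[Pr (Some x)]_o (g o)%:E <= K%:E)%E.
Proof.
move=> t0 cw w0c mg g0 gw PK.
have w0 y : 0 <= w y by have /andP[] := w0c y.
have mw : measurable_fun setT (fun o => at_cemetery0 w (X t o)).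
  by apply: measurableT_comp (measurable_process t0); exact:
    measurable_at_cemetery0.
have Pw : (P t w x)%:E = (\int[Pr (Some x)]_o (at_cemetery0 w (X t o))%:E)%E.
  apply: hMP => //; first exact: continuous_measurable_rV.
  by exists c => y; have /andP[? ?] := w0c y; rewrite ger0_norm.
have w0' o : 0 <= at_cemetery0 w (X t o) by case: (X t o).
have : (\int[Pr (Some x)]_o (g o)%:E + (P t w x)%:E <= c%:E)%E.
  rewrite Pw -ge0_integralD//; last first.
  - exact/measurable_EFinP.
  - by move=> o _; rewrite lee_fin.
  - exact/measurable_EFinP.
  - by move=> o _; rewrite lee_fin.
  have <- : (\int[Pr (Some x)]_(_ in setT) c%:E = c%:E)%E.
    rewrite integral_cst// -[RHS]mule1; congr (_ * _)%E; exact: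
      probability_setT.
  apply: ge0_le_integral => //.
  - by move=> o _; rewrite adde_ge0// lee_fin.
  - by apply: emeasurable_funD; exact/measurable_EFinP.
  - by move=> o _; rewrite -EFinD lee_fin.
move=> H; apply: (@le_trans _ _ (c - P t w x)%:E); last by rewrite lee_fin.
by rewrite EFinB leeBrDr.
Qed.

(** By absorption, a path that dies at a finite time sits at the cemetery at some integer time, and
    countably many null events remain. *)
Lemma lifetime_infty x :
  (forall t, 0 <= t -> Pr (Some x) [set o | X t o = None] = 0%E) ->
  Pr (Some x) [set o | lifetime X o = +oo%E] = 1%E.
Proof.
move=> H.
pose N := \bigcup_n [set o | X n%:R o = None].
have mX n : measurable [set o | X n%:R o = None].
  have := measurable_process (ler0n R n) measurableT measurable_cemetery.
  by rewrite setTI.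
have mN : measurable N by apply: bigcup_measurable.
have -> : [set o | lifetime X o = +oo%E] = ~` N.
  apply/seteqP; split=> o /=.
    move=> lo [n _ /= Xn].
    suff : (lifetime X o <= n%:R%:E)%E by rewrite lo leye_eq.
    by apply: ereal_inf_lbound; exists n%:R => //; split.
  move=> nN; rewrite /lifetime (_ : [set _ | _ in _] = set0) ?ereal_inf0//.
  apply/seteqP; split=> // y [t [t0 Xt] _]; apply: nN.
  exists (Num.bound t) => //=.
  apply: (process_absorbed hM t0 _ Xt); apply: ltW; exact: archi_boundP.
rewrite probability_setC// (_ : _ N = 0%E) ?sube0//.
apply/eqP; rewrite eq_le measure_ge0 andbT.
apply: (le_trans (measure_sigma_subadditive _ mX mN (@subset_refl _ _))).
by rewrite eseries0// => n _ _; exact: H.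
Qed.

End process_bound.

(** * Letting the truncation parameter tend to 0 *)

Section process_lyapunov.
Context {R : realType} {d : nat} {dO : measure_display} {Omega : measurableType
  dO}.
Local Notation E := 'rV[R]_d.
Local Notation S := (one_point_compactification 'rV[R]_d).
Local Notation c := (flat 1 (2^-1) : R).
Variables (Pr : S -> probability Omega R) (F : R -> set (set Omega)).
Variables (X : R -> Omega -> S) (P : R -> (E -> R) -> E -> R).
Hypothesis hM : hunt_process Pr F X.
Hypothesis hMP : has_transition_function Pr X P.
Variable phi : E -> R.
Hypothesis cphi : continuous phi.
Hypothesis phi0 : forall x, 0 <= phi x.
Variables (t K : R) (x : E).
Hypothesis t0 : 0 <= t.
Hypothesis K0 : 0 < K.
Hypothesis bound : forall k, 0 < k ->
  c - P t (flat_trunc k phi) x <= K * (c - flat_trunc k phi x).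

(** The lower bound of [flat1_sub_ge] at $q=k\varphi$, divided by $4ck$; it increases to [phi] as
    [k] decreases to 0. *)
Definition damped (k : R) (y : E) : R := phi y / (1 + 4 * k * phi y).

Let damped_den_gt0 k y : 0 < k -> 0 < 1 + 4 * k * phi y.
Proof. by move=> k0; rewrite ltr_pwDl// !mulr_ge0// ltW. Qed.

Lemma damped_ge0 k y : 0 < k -> 0 <= damped k y.
Proof. by move=> k0; rewrite divr_ge0// ltW// damped_den_gt0. Qed.

Lemma continuous_damped k : 0 < k -> continuous (damped k).
Proof.
move=> k0; have cden : continuous (fun y => (1 + 4 * k * phi y)^-1).
  move=> y; have cd := @continuous_affine R d 1 (4 * k) phi cphi.
  have nz : 1 + 4 * k * phi y != 0 by rewrite gt_eqF// damped_den_gt0.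
  exact (@continuousV _ _ (fun y => 1 + 4 * k * phi y) y nz (cd y)).
exact: continuous_mul.
Qed.

Let trunc_range k y : 0 < k -> 0 <= flat_trunc k phi y <= c.
Proof. by move=> k0; rewrite flat1_ge0/=; apply: flat1_le; exact: flat_arg_le.
  Qed.

Let trunc_bound k : 0 < k -> 2 * (k * phi x) < 1 ->
  c - P t (flat_trunc k phi) x <=
  c * (K * (4 * (k * phi x) / (1 - 2 * (k * phi x)))).
Proof.
move=> k0 kx; apply: (le_trans (bound k0)).
rewrite mulrCA; apply: ler_wpM2l; first exact: ltW.
by apply: flat1_sub_le => //; rewrite mulr_ge0// ltW.
Qed.

(** [expectation_le] with [g] equal to [c] on the event and 0 elsewhere: $w$ is 0 at the cemetery
    and at most [c] on the space. The right-hand side tends to 0 with [k]. *)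
Lemma death_probability_le k : 0 < k -> 2 * (k * phi x) < 1 ->
  (Pr (Some x) [set o | X t o = None] <=
   (K * (4 * (k * phi x) / (1 - 2 * (k * phi x))))%:E)%E.
Proof.
move=> k0 kx; set A := [set o | _].
have mA : measurable A.
  have := measurable_process hM t0 measurableT measurable_cemetery.
  by rewrite setTI.
have mg : measurable_fun setT (\1_A : Omega -> R) by exact: measurable_indic.
have cc : 0 < c := flat1_half_gt0.
have : (\int[Pr (Some x)]_o (c * \1_A o)%:E <=
    (c * (K * (4 * (k * phi x) / (1 - 2 * (k * phi x)))))%:E)%E.
  apply: (expectation_le (w := flat_trunc k phi) hM hMP t0 _ _ _ _ _
    (trunc_bound k0 kx)).
  - exact: continuous_flat_trunc.
  - by move=> y; exact: trunc_range.
  - exact: measurable_funM.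
  - by move=> o; rewrite mulr_ge0// ltW.
  - move=> o; rewrite indicE; case: (pselect (A o)) => Xo.
      by rewrite mem_set// mulr1 (_ : X t o = None)//= addr0.
    rewrite memNset// mulr0 add0r; case: (X t o) => [y|] /=; last exact: ltW.
    by have /andP[] := trunc_range y k0.
have -> : (\int[Pr (Some x)]_o (c * \1_A o)%:E = c%:E * Pr (Some x) A)%E.
  rewrite -[A in RHS]setIT -integral_indic//.
  have mg' : measurable_fun setT (fun o => (\1_A o : R)%:E) by
    exact/measurable_EFinP.
  by apply: (ge0_integralZl_EFin _ measurableT _ mg' (ltW cc)) => o _; rewrite
    lee_fin.
by rewrite EFinM lee_pmul2l.
Qed.

Lemma damped_expectation_le k : 0 < k -> 2 * (k * phi x) < 1 ->
  (\int[Pr (Some x)]_o (at_cemetery0 (damped k) (X t o))%:E <=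
   (K * (phi x / (1 - 2 * (k * phi x))))%:E)%E.
Proof.
move=> k0 kx.
have mo : measurable_fun setT (fun o => at_cemetery0 (damped k) (X t o)).
  apply: measurableT_comp (measurable_process hM t0).
  by apply: measurable_at_cemetery0; [exact: continuous_damped|move=> y; exact:
    damped_ge0].
have o0 o : 0 <= at_cemetery0 (damped k) (X t o).
  by case: (X t o) => //= y; exact: damped_ge0.
have cc : 0 < c := flat1_half_gt0.
pose a := c * (4 * k).
have a0 : 0 < a by rewrite !mulr_gt0.
have : (\int[Pr (Some x)]_o (a * at_cemetery0 (damped k) (X t o))%:E <=
    (a * (K * (phi x / (1 - 2 * (k * phi x)))))%:E)%E.
  rewrite (_ : a * (K * _) = c * (K * (4 * (k * phi x) / (1 - 2 * (k * phi
    x)))));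
    last by rewrite /a; ring.
  apply: (expectation_le (w := flat_trunc k phi) hM hMP t0 _ _ _ _ _
    (trunc_bound k0 kx)).
  - exact: continuous_flat_trunc.
  - by move=> y; exact: trunc_range.
  - exact: measurable_funM.
  - by move=> o; rewrite mulr_ge0// ltW.
  - move=> o; case: (X t o) => [y|] /=; last by rewrite mulr0 add0r ltW.
    have := flat1_sub_ge (mulr_ge0 (ltW k0) (phi0 y)).
    rewrite (_ : c * (_ / _) = a * damped k y); last by rewrite /a /damped
      -(mulrA 4); ring.
    by rewrite lerBrDr.
have -> : (\int[Pr (Some x)]_o (a * at_cemetery0 (damped k) (X t o))%:E =
    a%:E * \int[Pr (Some x)]_o (at_cemetery0 (damped k) (X t o))%:E)%E.
  have mo' : measurable_fun setT (fun o => (at_cemetery0 (damped k) (X t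
    o))%:E).
    exact/measurable_EFinP.
  by apply: (ge0_integralZl_EFin _ measurableT _ mo' (ltW a0)) => o _; rewrite
    lee_fin.
by rewrite (EFinM a) lee_pmul2l.
Qed.

Lemma death_probability0 : Pr (Some x) [set o | X t o = None] = 0%E.
Proof.
apply/eqP; rewrite eq_le measure_ge0 andbT.
apply/lee_addgt0Pr => e e0; rewrite add0e.
pose s := phi x; have s0 : 0 <= s by exact: phi0.
have s10 : 0 < s + 1 by rewrite ltr_wpDl.
(* The first bound gives $1-2ks\ge1/2$, so the estimate is at most $8Kks$, and the second makes this
   at most [e]. Using $s+1$ avoids a division by 0 when [phi x] is 0. *)
pose k := Num.min ((4 * (s + 1))^-1) (e / (8 * K * (s + 1))).
have k0 : 0 < k by rewrite lt_min invr_gt0 divr_gt0 ?mulr_gt0.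
have k1 : k * (4 * (s + 1)) <= 1.
  by rewrite -ler_pdivlMr ?mulr_gt0// mul1r ge_min lexx.
have k2 : k * (8 * K * (s + 1)) <= e.
  by rewrite -ler_pdivlMr ?mulr_gt0// ge_min lexx orbT.
have ks0 : 0 <= k * s by rewrite mulr_ge0// ltW.
have ks : 4 * (k * s) <= 1.
  apply: le_trans k1; rewrite [leRHS]mulrCA; apply: ler_wpM2l => //.
  by rewrite ler_wpM2l ?(ltW k0)// lerDl.
have ks2 : 2 * (k * s) < 1 by lra.
apply: (le_trans (death_probability_le k0 ks2)); rewrite lee_fin -/s.
apply: le_trans k2; rewrite [leRHS](_ : _ = K * (8 * (k * (s + 1)))); last by
  ring.
apply: ler_wpM2l; first exact: ltW.
have d0 : 0 < 1 - 2 * (k * s) by lra.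
have q1 : k * s <= k * (s + 1) by rewrite ler_wpM2l ?(ltW k0)// lerDl.
rewrite ler_pdivrMr//.
move: (k * s) (k * (s + 1)) ks0 q1 ks => q Q q0 qQ q4.
have : Q * 2^-1 <= Q * (1 - 2 * q) by apply: ler_wpM2l; lra.
lra.
Qed.

(** Monotone convergence along $k=1/(n+1)$, so that integrability of [phi] under the law of $X_t$ is
    a conclusion. *)
Lemma expectation_lyapunov :
  (\int[Pr (Some x)]_o (at_cemetery0 phi (X t o))%:E <= (K * phi x)%:E)%E.
Proof.
pose kn n : R := n.+1%:R^-1.
have kn0 n : 0 < kn n by rewrite invr_gt0.
pose g n (o : Omega) := (at_cemetery0 (damped (kn n)) (X t o))%:E.
have kn_cvg : kn n @[n --> \oo] --> (0 : R) by exact: cvg_harmonic.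
have cv : (\int[Pr (Some x)]_o g n o @[n --> \oo] -->
    \int[Pr (Some x)]_o (at_cemetery0 phi (X t o))%:E)%E.
  rewrite (_ : (\int[_]_o (at_cemetery0 phi _)%:E)%E =
      (\int[Pr (Some x)]_o (limn (g ^~ o)))%E); last first.
    apply: eq_integral => o _; apply/esym/cvg_lim => //.
    rewrite /g; case: (X t o) => [y|] /=; last exact: cvg_cst.
    apply: cvg_EFin; first exact: nearW.
    have : damped (kn n) y @[n --> \oo] --> phi y / (1 + 4 * 0 * phi y).
      apply: cvgM; first exact: cvg_cst.
      apply: cvgV; first by rewrite mulr0 mul0r addr0 oner_neq0.
      apply: cvgD; first exact: cvg_cst.
      apply: cvgM; last exact: cvg_cst.
      by apply: cvgM => //; exact: cvg_cst.
    by rewrite mulr0 mul0r addr0 divr1.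
  apply: cvg_monotone_convergence => //.
  - move=> n; apply/measurable_EFinP; apply: measurableT_comp
      (measurable_process hM t0).
    by apply: measurable_at_cemetery0; [exact: continuous_damped|move=> y;
      exact: damped_ge0].
  - move=> n o _; rewrite /g lee_fin; case: (X t o) => //= y; exact: damped_ge0.
  - move=> o _ m n mn; rewrite /g lee_fin; case: (X t o) => //= y.
    rewrite /damped ler_wpM2l// lef_pV2 ?posrE ?damped_den_gt0//.
    rewrite lerD2l ler_wpM2r// ler_wpM2l// /kn lef_pV2 ?posrE ?ltr0n//.
    by rewrite ler_nat ltnS.
apply/lee_addgt0Pr => e e0; rewrite -EFinD.
apply: cvge_le cv.
pose s := phi x; have s0 : 0 <= s by exact: phi0.
have s10 : 0 < s + 1 by rewrite ltr_wpDl.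
(* With $q=k_ns\le1/4$, the excess $s/(1-2q)-s=2qs/(1-2q)$ is at most $4qs\le4k(s+1)^2$, that is, at
   most $e/K$. *)
pose k := Num.min ((4 * (s + 1))^-1) (e / (4 * K * (s + 1) ^+ 2)).
have k0 : 0 < k by rewrite lt_min invr_gt0 divr_gt0 ?mulr_gt0 ?exprn_gt0.
have : \forall n \near \oo, kn n < k.
  move/cvgrPdist_lt : kn_cvg => /(_ k k0); apply: filterS => n.
  by rewrite sub0r normrN gtr0_norm.
apply: filterS => n nk.
have k1 : k * (4 * (s + 1)) <= 1.
  by rewrite -ler_pdivlMr ?mulr_gt0// mul1r ge_min lexx.
have k2 : k * (4 * K * (s + 1) ^+ 2) <= e.
  by rewrite -ler_pdivlMr ?mulr_gt0 ?exprn_gt0// ge_min lexx orbT.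
have ns0 : 0 <= kn n * s by rewrite mulr_ge0// ltW.
have nks : kn n * s <= k * s by rewrite ler_wpM2r// ltW.
have ks : 4 * (k * s) <= 1.
  apply: le_trans k1; rewrite [leRHS]mulrCA; apply: ler_wpM2l => //.
  by rewrite ler_wpM2l ?(ltW k0)// lerDl.
have ks2 : 2 * (kn n * s) < 1 by lra.
apply: (le_trans (damped_expectation_le (kn0 n) ks2)); rewrite lee_fin -/s.
rewrite -lerBlDl -mulrBr.
apply: le_trans k2; rewrite [leRHS](_ : _ = K * (4 * (k * (s + 1)) * (s + 1)));
  last by ring.
apply: ler_wpM2l; first exact: ltW.
have d0 : 0 < 1 - 2 * (kn n * s) by lra.
rewrite lerBlDr ler_pdivrMr//.
have q1 : kn n * s <= k * (s + 1) by rewrite (le_trans nks)// ler_wpM2l ?(ltW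
  k0)// lerDl.
have q4 : 4 * (kn n * s) <= 1 by lra.
move: (kn n * s) (k * (s + 1)) ns0 q1 q4 => q Q q0 qQ q4.
have Qs : 0 <= Q * (s + 1) by rewrite mulr_ge0 ?(le_trans q0 qQ)// ltW.
have : q * s <= Q * (s + 1) by rewrite ler_pM// lerDl.
have : Q * (s + 1) * (2 * q) <= Q * (s + 1) * 2^-1 by apply: ler_wpM2l => //;
  lra.
lra.
Qed.

End process_lyapunov.

Unset Implicit Arguments. Set Strict Implicit. Set Printing Implicit Defensive.

Theorem proposition3p25 (R : realType) (d : nat) (hd : (2 <= d)%N)
  (p : R) (hp : d%:R < p)
  (A C : 'rV[R]_d -> 'M[R]_d) (H : 'rV[R]_d -> 'rV[R]_d)
  (ha : assumption_a p A C H) (hb : assumption_b p A C H)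
  (rho : 'rV[R]_d -> R) (mu : {measure set 'rV[R]_d -> \bar R})
  (hrho : invariant_density p A C H rho mu)
  (T : R -> ('rV[R]_d -> R) -> 'rV[R]_d -> R)
  (hT : L1_semigroup A C H rho mu T)
  (P : R -> ('rV[R]_d -> R) -> 'rV[R]_d -> R)
  (hP : transition_function mu T P)
  (dO : measure_display) (Omega : measurableType dO)
  (Pr : one_point_compactification 'rV[R]_d -> probability Omega R)
  (F : R -> set (set Omega))
  (X : R -> Omega -> one_point_compactification 'rV[R]_d)
  (hM : hunt_process Pr F X) (hMP : has_transition_function Pr X P)
  (phi : 'rV[R]_d -> R) (M : R)
  (hphi : Ck 2 phi) (phi_ge0 : forall x, 0 <= phi x)
  (phi_oo : inf [set phi x | x in [set x | enorm x = r]] @[r --> +oo] --> +oo)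
  (hM0 : 0 < M)
  (hL : {ae lebesgue_rV d, forall x, Lop A C H phi x <= M * phi x}) :
  non_explosive Pr X /\
  forall (x : 'rV[R]_d) (t : R), 0 <= t ->
    (\int[Pr (Some x)]_w (at_cemetery0 phi (X t w))%:E <=
     (expR (M * t) * phi x)%:E)%E.
Proof.
have cphi : continuous phi := Ck_continuous hphi.
have bound x t : 0 <= t -> forall k : R, 0 < k ->
    flat 1 2^-1 - P t (flat_trunc k phi) x <=
    expR (M * t) * (flat 1 2^-1 - flat_trunc k phi x).
  (* The radius depends on [k] but does not enter the bound, so [k] remains free to tend to 0. *)
  move=> t0 k k0; have [r r0 far] := coercive_far phi_ge0 k0 phi_oo.
  have cw : continuous (flat_trunc k phi) by exact: continuous_flat_trunc.
  move: t0; rewrite le_eqVlt => /predU1P[<-|t0].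
    by rewrite hP.1 mulr0 expR0 mul1r.
  have w1 := L1_trunc hrho hphi phi_ge0 k0 far.
  have wc y : `|flat_trunc k phi y| <= flat 1 2^-1.
    by rewrite ger0_norm ?flat1_ge0//; apply: flat1_le; exact: flat_arg_le.
  have [cP PT] :=
    transition_ae_eq (L1_semigroup_C0 hT) hP t0 ((inLpT1 _ _).2 w1) wc.
  have Tw := semigroup_trunc_le hd hp ha hb hrho hT hphi phi_ge0 hM0 hL
    k0 r0 far t0.
  apply: (ae_le_continuous (rho_continuous hrho) (rho_gt0 hrho) (mu_density hrho)
    (f := fun x => flat 1 2^-1 - P t (flat_trunc k phi) x)
    (g := fun x => expR (M * t) * (flat 1 2^-1 - flat_trunc k phi x))).
  - rewrite (_ : (fun x => _) =
        fun x => flat 1 2^-1 + (-1) * P t (flat_trunc k phi) x).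
      exact: continuous_affine.
    by apply/funext => y; rewrite mulN1r.
  - rewrite (_ : (fun x => _) = fun x => expR (M * t) * flat 1 2^-1 +
        (- expR (M * t)) * flat_trunc k phi x).
      exact: continuous_affine.
    by apply/funext => y; rewrite mulrBr mulNr.
  - by move: PT Tw; apply: filterS2 => y ->.
split=> [x|x t t0].
  apply: (lifetime_infty hM) => t t0.
  exact: (death_probability0 hM hMP cphi phi_ge0 t0 (expR_gt0 _) (bound x t t0)).
exact: (expectation_lyapunov hM hMP cphi phi_ge0 t0 (expR_gt0 _) (bound x t t0)).
Qed.
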